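(* For each $n$ (with $p=p_n$), let $X_1,\dots,X_n\in\mathbb{R}^p$ be independent Gaussian random vectors with mean $0$ and identical covariance $\Sigma$, let $R_1,\dots,R_n>0$ be deterministic, let $A$ be a deterministic $p\times p$ matrix with $A\succeq t\,\mathrm{Id}$, where $t>0$ is fixed, and let $v\in\mathbb{R}^p$ be deterministic with $\|v\|=1$ (here $\Sigma$, $A$, $v$ and the $R_j$ may depend on $n$). Let $\mathcal{S}=\frac1n\sum_{j=1}^nR_j^2X_jX_j^\top$. Suppose that the ratio $p/n$ stays bounded and that, as $n\to\infty$, $$\sum_{j=1}^n\frac{R_j^2}{n}\|\Sigma\|_{op}=O(1)\qquad\text{and}\qquad\sum_{j=1}^n\left(\frac{R_j^2}{n}\wedge\frac{R_j^4}{n^{3/2}}\|\Sigma\|_{op}\right)\|\Sigma\|_{op}=o(1).$$ Then, as $n\to\infty$, $$\mathbb{E}\left[v^\top(\mathcal{S}+A)^{-1}v\right]-\mathbb{E}\left[v^\top(\gamma(A)\Sigma+A)^{-1}v\right]\to0,$$ where $$\gamma(A)=\frac1n\sum_{i=1}^n\frac{R_i^2}{1+\frac1nR_i^2\,\mathrm{trace}\left(\Sigma(\mathcal{S}+A)^{-1}\right)} .$$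
   Context: $a\wedge b=\min(a,b)$; $\|\cdot\|_{op}$ is the operator norm; $\succeq$ is the Loewner order on symmetric matrices. Note that $\gamma(A)$ is a random variable. *)

(* Defs.v *)
From HB Require Import structures.
From mathcomp Require Import all_boot all_order all_algebra.
From mathcomp Require Import all_classical all_reals all_analysis.
Set Implicit Arguments.
Unset Strict Implicit.
Unset Printing Implicit Defensive.
Import Order.TTheory GRing.Theory Num.Theory.
Import numFieldNormedType.Exports.
Local Open Scope classical_set_scope.
Local Open Scope ring_scope.

Section linear_algebra.
Context {R : realType} {p : nat}.
Implicit Types (x : 'cV[R]_p) (M N : 'M[R]_p).

(* Not the library norm `|x|, which is the max norm on matrices. *)
Definition euclidean_norm x : R := Num.sqrt (\sum_i x i 0 ^+ 2).

Definition operator_norm M : R :=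
  sup [set euclidean_norm (M *m x) | x in [set x | euclidean_norm x <= 1]].

Definition quad_form M x : R := (x^T *m M *m x) 0 0.

Definition loewner_le M N : Prop :=
  [/\ M^T = M, N^T = N & forall x, 0 <= quad_form (N - M) x].

End linear_algebra.

Section random_vectors.
Context {d : measure_display} {T : measurableType d} {R : realType}
  (P : probability T R).

(* Random vectors take values in p.-tuple R, whose canonical sigma-algebra is
   the product Borel one; the library has none on 'cV[R]_p. *)
Definition colv {p : nat} (x : p.-tuple R) : 'cV[R]_p := \col_i tnth x i.

(* The library's normal_prob m 0 is the uniform law on [0, 1], so the
   degenerate case has to be given separately. *)
Definition gaussian_law (m s : R) : set R -> \bar R :=
  if s == 0 then \d_m else normal_prob m s.

(* The covariance matrix may be singular, hence no density; the measurable
   function w |-> u^T X(w) has its law written as a preimage. *)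
Definition gaussian_vector {p : nat} (X : {RV P >-> p.-tuple R}) : Prop :=
  forall u : 'cV[R]_p, exists m s : R, forall B : set R, measurable B ->
    P ((fun w => (u^T *m colv (X w)) 0 0) @^-1` B) = gaussian_law m s B.

Definition centered {p : nat} (X : {RV P >-> p.-tuple R}) : Prop :=
  forall i, ('E_P[fun w => tnth (X w) i] = 0)%E.

Definition has_covariance {p : nat} (X : {RV P >-> p.-tuple R})
    (Sigma : 'M[R]_p) : Prop :=
  forall i k,
    covariance P (fun w => tnth (X w) i) (fun w => tnth (X w) k)
      = (Sigma i k)%:E.

Definition mutually_independent {d' : measure_display} {T' : measurableType d'}
    {n : nat} (X : 'I_n -> {RV P >-> T'}) : Prop :=
  forall (J : {set 'I_n}) (B : 'I_n -> set T'), (forall j, measurable (B j)) ->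
    P (\bigcap_(j in [set` J]) (X j @^-1` B j))
      = (\prod_(j in J) P (X j @^-1` B j))%E.

Context {n p : nat} (r : 'I_n -> R) (X : 'I_n -> {RV P >-> p.-tuple R}).

Definition weighted_cov (w : T) : 'M[R]_p :=
  n%:R^-1 *: \sum_(j < n) r j ^+ 2 *: (colv (X j w) *m (colv (X j w))^T).

Definition gamma (Sigma A : 'M[R]_p) (w : T) : R :=
  n%:R^-1 * \sum_(i < n)
    (r i ^+ 2 /
      (1 + n%:R^-1 * r i ^+ 2 * \tr (Sigma *m invmx (weighted_cov w + A)))).

End random_vectors.

(* Main.v *)
Require Import Defs.
From HB Require Import structures.
From mathcomp Require Import all_boot all_order all_algebra.
From mathcomp Require Import all_classical all_reals all_analysis.
From mathcomp Require Import measurable_realfun.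
From mathcomp Require Import ring lra.
Import Order.TTheory GRing.Theory Num.Theory.
Import numFieldNormedType.Exports.
Local Open Scope classical_set_scope.
Local Open Scope ring_scope.
Set Implicit Arguments.
Unset Strict Implicit.
Unset Printing Implicit Defensive.

(** Write [s_j = R_j^2 / n], [sigma] for the operator norm of [Sigma],
    [Q = (S + A)^-1], [tau = trace (Sigma Q)] and [taub = E tau], so that
    [gamma = sum_j s_j / (1 + s_j tau)]. At a fixed sample size the two
    expectations differ by at most
      [K sum_j s_j min (sigma, s_j sqrt n sigma^2)],
    where [K] depends on [t] and on a bound for [p / n] only
    ([resolvent_deterministic_equivalent]). Up to notation this sum is the one
    that tends to [0] by assumption. Both expectations are compared with the
    number [v^T u], where [u = (gb Sigma + A)^-1 v] and [gb] is [gamma] with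
    [tau] replaced by [taub].

    Concentration. By the Sherman-Morrison formula, removing one vector from the
    sample moves [tau] by at most [sigma / t], however large the vector is
    ([mxtrace_invmx_update_dist]). The Efron-Stein inequality ([efron_stein])
    then bounds the variance of [tau] by [2 n sigma^2 / t^2]. As
    [x |-> 1 / (1 + s x)] moves by at most [min (1, s |x - y|)] ([inv1D_dist]),
    replacing [gamma] by [gb] costs no more than the announced sum.

    Leaving one vector out. The resolvent identity writes [v^T Q v - v^T u] as
    the sum of the [s_j residual_j], where [residual_j] is
      [(1 + s_j taub)^-1 v^T Q Sigma u - (v^T Q X_j) (X_j^T u)].
    Independence allows one to resample [X_j] with the other vectors held fixed
    ([Ex_replace]). With [M] the resolvent without [X_j] and [q = X_j^T M X_j],
    the Sherman-Morrison formula gives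
      [v^T Q X_j = v^T M X_j / (1 + s_j q)],
    and if [q] were equal to [taub] the two terms of [residual_j] would cancel
    in expectation, except for the rank-one correction in its first term. The
    error made by replacing [q] by [taub] is at most [s_j |q - taub|] relative
    to [|v^T M X_j| |X_j^T u|]; here [q] has variance
    [2 trace (Sigma M Sigma M) <= 2 p sigma^2 / t^2] and conditional mean
    [trace (Sigma M)], which is close to [tau], hence to [taub]. This is
    [Ex_residual_le_var], of order [s_j sqrt n sigma^2]; the crude bound of order
    [sigma] is [Ex_residual_le_cst].

    Tools. Independence enters through one exchange principle
    ([Ex_exchange]): on the product of the probability space with itself, the
    law of the pair of samples does not change when some of the vectors of the
    first sample are exchanged with their counterparts in the second. The
    moments of order four of a Gaussian vector come from those of its linear
    forms by polarization ([isserlis]), and these from integration by parts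
    ([half_moment_recur]). *)

(** * Euclidean vectors, operator norm and coercive matrices *)

Section linear_algebra.
Context {R : realType} {p : nat}.
Implicit Types (x y z u v : 'cV[R]_p) (M N B S : 'M[R]_p) (a s t : R).

Definition dotv x y : R := (x^T *m y) 0 0.

Lemma dotvE x y : dotv x y = \sum_i x i 0 * y i 0.
Proof. by rewrite /dotv mxE; apply: eq_bigr => i _; rewrite mxE. Qed.

Lemma dotvC x y : dotv x y = dotv y x.
Proof. by rewrite !dotvE; apply: eq_bigr => i _; rewrite mulrC. Qed.

Lemma dotvDl x y z : dotv (x + y) z = dotv x z + dotv y z.
Proof. by rewrite /dotv linearD mulmxDl mxE. Qed.

Lemma dotvDr x y z : dotv z (x + y) = dotv z x + dotv z y.
Proof. by rewrite /dotv mulmxDr mxE. Qed.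

Lemma dotvZl a x y : dotv (a *: x) y = a * dotv x y.
Proof. by rewrite /dotv linearZ -scalemxAl mxE. Qed.

Lemma dotvZr a x y : dotv x (a *: y) = a * dotv x y.
Proof. by rewrite dotvC dotvZl dotvC. Qed.

Lemma dotv0r x : dotv x 0 = 0.
Proof. by rewrite /dotv mulmx0 mxE. Qed.

Lemma dotvNr x y : dotv x (- y) = - dotv x y.
Proof. by rewrite -scaleN1r dotvZr mulN1r. Qed.

Lemma dotvNl x y : dotv (- x) y = - dotv x y.
Proof. by rewrite dotvC dotvNr dotvC. Qed.

Lemma dotvBl x y z : dotv (x - y) z = dotv x z - dotv y z.
Proof. by rewrite dotvC dotvDr dotvNr !(dotvC z). Qed.

Lemma dotvBr x y z : dotv z (x - y) = dotv z x - dotv z y.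
Proof. by rewrite dotvDr dotvNr. Qed.

Lemma dotv_mulmx M x y : dotv x (M *m y) = dotv (M^T *m x) y.
Proof. by rewrite /dotv trmx_mul trmxK mulmxA. Qed.

Lemma dotv_sumr I (r : seq I) (P : pred I) (F : I -> 'cV[R]_p) x :
  dotv x (\sum_(i <- r | P i) F i) = \sum_(i <- r | P i) dotv x (F i).
Proof. by rewrite /dotv mulmx_sumr summxE. Qed.

Lemma outer_mulmx x y z : x *m y^T *m z = dotv y z *: x.
Proof.
by rewrite -mulmxA [y^T *m z]mx11_scalar mul_mx_scalar.
Qed.

Lemma quad_formE M x : quad_form M x = dotv x (M *m x).
Proof. by rewrite /quad_form /dotv mulmxA. Qed.

Lemma dotv_ge0 x : 0 <= dotv x x.
Proof. by rewrite dotvE sumr_ge0// => i _; rewrite -expr2 sqr_ge0. Qed.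

Lemma dotv_eq0 x : dotv x x = 0 -> x = 0.
Proof.
rewrite dotvE => /eqP; rewrite psumr_eq0; last first.
  by move=> i _; rewrite -expr2 sqr_ge0.
move=> /allP h; apply/matrixP => i j; rewrite (ord1 j) mxE.
have := h i (mem_index_enum _); rewrite /= -expr2 sqrf_eq0 => /eqP; exact.
Qed.

Lemma enormE x : euclidean_norm x = Num.sqrt (dotv x x).
Proof. by congr Num.sqrt; rewrite dotvE; apply: eq_bigr => i _; rewrite expr2. Qed.

Lemma enorm_ge0 x : 0 <= euclidean_norm x.
Proof. exact: sqrtr_ge0. Qed.

Lemma enorm0 : euclidean_norm (0 : 'cV[R]_p) = 0.
Proof. by rewrite enormE dotv0r sqrtr0. Qed.

Lemma sqr_enorm x : euclidean_norm x ^+ 2 = dotv x x.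
Proof. by rewrite enormE sqr_sqrtr// dotv_ge0. Qed.

Lemma enorm_eq0 x : euclidean_norm x = 0 -> x = 0.
Proof. by move=> h; apply: dotv_eq0; rewrite -sqr_enorm h expr0n. Qed.

Lemma enormZ a x : euclidean_norm (a *: x) = `|a| * euclidean_norm x.
Proof.
by rewrite !enormE dotvZl dotvZr mulrA -expr2 sqrtrM ?sqr_ge0// sqrtr_sqr.
Qed.

Lemma cauchy_schwarz x y : `|dotv x y| <= euclidean_norm x * euclidean_norm y.
Proof.
have [/eqP/enorm_eq0->|x0] := boolP (euclidean_norm x == 0).
  by rewrite dotvC dotv0r normr0 mulr_ge0// enorm_ge0.
have nx : 0 < euclidean_norm x by rewrite lt_def x0 enorm_ge0.
rewrite -(@ler_pXn2r _ 2%N)// ?nnegrE ?mulr_ge0 ?enorm_ge0//.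
rewrite real_normK ?num_real// exprMn !sqr_enorm.
have xx : 0 < dotv x x by rewrite -sqr_enorm exprn_gt0.
have := dotv_ge0 (dotv x x *: y - dotv x y *: x).
rewrite !(dotvBl, dotvBr, dotvZl, dotvZr) (dotvC y x).
set q := dotv x x in xx *; set b := dotv x y; set c := dotv y y.
rewrite [X in _ <= X](_ : _ = q * (q * c - b ^+ 2)); last by ring.
by rewrite pmulr_rge0// subr_ge0.
Qed.

Lemma le_dotv x y a b : euclidean_norm x <= a -> euclidean_norm y <= b ->
  `|dotv x y| <= a * b.
Proof.
move=> xa yb; apply: le_trans (cauchy_schwarz x y) _.
by rewrite ler_pM// enorm_ge0.
Qed.

(** ** Operator norm *)

(** The supremum defining [operator_norm] is finite: by Cauchy-Schwarz on the
    rows, the Frobenius norm is an upper bound. *)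
Lemma enorm_mulmx_bounded M :
  has_sup [set euclidean_norm (M *m x) | x in [set x | euclidean_norm x <= 1]].
Proof.
split.
  exists (euclidean_norm (M *m 0)); exists 0 => //=.
  by rewrite enorm0 ler01.
exists (Num.sqrt (\sum_i \sum_j M i j ^+ 2)) => _ [x /= x1 <-].
rewrite ler_wsqrtr//; apply: ler_sum => i _.
have -> : (M *m x) i 0 = dotv (row i M)^T x.
  by rewrite dotvE mxE; apply: eq_bigr => j _; rewrite !mxE.
have := le_dotv (lexx _) x1 : `|dotv (row i M)^T x| <= _.
rewrite mulr1 => h.
have {}h : dotv (row i M)^T x ^+ 2 <= euclidean_norm (row i M)^T ^+ 2.
  by rewrite -real_normK ?num_real// ler_pXn2r// nnegrE enorm_ge0.
apply: (le_trans h).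
by rewrite sqr_enorm dotvE ler_sum// => j _; rewrite !mxE expr2.
Qed.

Lemma operator_norm_ge0 M : 0 <= operator_norm M.
Proof.
apply: le_trans (enorm_ge0 (M *m 0)) _.
apply: ub_le_sup; first by have [] := enorm_mulmx_bounded M.
by exists 0 => //=; rewrite enorm0 ler01.
Qed.

Lemma enorm_mulmx M x :
  euclidean_norm (M *m x) <= operator_norm M * euclidean_norm x.
Proof.
have [/eqP/enorm_eq0->|x0] := boolP (euclidean_norm x == 0).
  by rewrite mulmx0 enorm0 mulr0.
have nx : 0 < euclidean_norm x by rewrite lt_def x0 enorm_ge0.
rewrite -ler_pdivrMr// mulrC -[(euclidean_norm x)^-1]ger0_norm ?invr_ge0 ?enorm_ge0//.
rewrite -enormZ scalemxAr.
apply: ub_le_sup; first by case: (enorm_mulmx_bounded M).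
exists ((euclidean_norm x)^-1 *: x) => //=.
by rewrite enormZ ger0_norm ?invr_ge0 ?enorm_ge0// mulVf.
Qed.

(** ** Coercive matrices and their inverses *)

Definition coercive t M := M^T = M /\ forall x, t * dotv x x <= dotv x (M *m x).

Definition psdmx M := M^T = M /\ forall x, 0 <= dotv x (M *m x).

Lemma loewner_ge_coercive t M : loewner_le t%:M M -> coercive t M.
Proof.
move=> [_ tM h]; split=> // x; have := h x.
by rewrite quad_formE mulmxBl dotvBr subr_ge0 mul_scalar_mx dotvZr.
Qed.

Lemma coerciveD t M N : psdmx M -> coercive t N -> coercive t (M + N).
Proof.
move=> [tM M0] [tN Nt]; split; first by rewrite linearD /= tM tN.
by move=> x; rewrite mulmxDl dotvDr; have := M0 x; have := Nt x; lra.
Qed.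

Lemma psdmxD M N : psdmx M -> psdmx N -> psdmx (M + N).
Proof.
move=> [tM M0] [tN N0]; split; first by rewrite linearD /= tM tN.
by move=> x; rewrite mulmxDl dotvDr addr_ge0.
Qed.

Lemma psdmxZ a M : 0 <= a -> psdmx M -> psdmx (a *: M).
Proof.
move=> a0 [tM M0]; split; first by rewrite linearZ /= tM.
by move=> x; rewrite -scalemxAl dotvZr mulr_ge0.
Qed.

Lemma psdmx_outer x : psdmx (x *m x^T).
Proof.
split; first by rewrite trmx_mul trmxK.
by move=> y; rewrite outer_mulmx dotvZr dotvC -expr2 sqr_ge0.
Qed.

Lemma psdmx_sum I (r : seq I) (P : pred I) (F : I -> 'M[R]_p) :
  (forall i, P i -> psdmx (F i)) -> psdmx (\sum_(i <- r | P i) F i).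
Proof.
move=> h; elim/big_ind: _ => //; last exact: psdmxD.
split; first exact: trmx0.
by move=> x; rewrite mul0mx dotv0r.
Qed.

Section inverse.
Variables (t : R) (M : 'M[R]_p).
Hypotheses (t0 : 0 < t) (Mt : coercive t M).

(** A vector in the kernel has a vanishing quadratic form, hence is zero. *)
Lemma coercive_unit : M \in unitmx.
Proof.
rewrite -unitmx_tr -row_free_unit -kermx_eq0; apply/eqP/row_matrixP => i.
rewrite row0; apply: trmx_inj; rewrite trmx0; apply: dotv_eq0.
set x := (row i _)^T.
have Mx : M *m x = 0.
  apply: trmx_inj; rewrite trmx_mul /x trmxK trmx0 -row_mul mulmx_ker row0 //.
have [_ /(_ x)] := Mt; rewrite Mx dotv0r pmulr_rle0// => h.
by apply/eqP; rewrite eq_le h dotv_ge0.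
Qed.

Lemma trmx_inv_coercive : (invmx M)^T = invmx M.
Proof. by rewrite trmx_inv; have [-> _] := Mt. Qed.

(** This is coercivity of [M] at the vector [invmx M *m x]; the bounds on the
    inverse that follow are consequences of it. *)
Lemma dotv_inv_coercive x :
  t * dotv (invmx M *m x) (invmx M *m x) <= dotv x (invmx M *m x).
Proof.
have [_ /(_ (invmx M *m x))] := Mt.
by rewrite mulmxA mulmxV ?coercive_unit// mul1mx [in X in _ -> _ <= X]dotvC.
Qed.

Lemma psdmx_inv_coercive : psdmx (invmx M).
Proof.
split; first exact: trmx_inv_coercive.
move=> x; apply: le_trans (dotv_inv_coercive x).
by rewrite mulr_ge0 ?dotv_ge0// ltW.
Qed.

Lemma enorm_inv_coercive x :
  euclidean_norm (invmx M *m x) <= euclidean_norm x / t.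
Proof.
set y := invmx M *m x; rewrite ler_pdivlMr//.
have [/eqP->|y0] := boolP (euclidean_norm y == 0).
  by rewrite mul0r enorm_ge0.
have ny : 0 < euclidean_norm y by rewrite lt_def y0 enorm_ge0.
have := dotv_inv_coercive x; rewrite -/y -sqr_enorm => h.
have {h} := le_trans h (le_trans (ler_norm _) (cauchy_schwarz x y)).
by rewrite expr2 mulrA ler_pM2r// mulrC.
Qed.

End inverse.

(** The right-hand side is checked to be a right inverse; the coefficient [k]
    makes the multiples of [x *m u^T] cancel. *)
Lemma sherman_morrison t B s x (k := s / (1 + s * dotv x (invmx B *m x)))
    (u := invmx B *m x) : 0 < t -> coercive t B -> 0 <= s ->
  invmx (s *: (x *m x^T) + B) = invmx B - k *: (u *m u^T).
Proof.
move=> t0 Bt s0.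
have q0 : 0 <= dotv x u by have [_] := psdmx_inv_coercive t0 Bt; apply.
have q1 : 1 + s * dotv x u != 0 by rewrite gt_eqF// ltr_pwDl// mulr_ge0.
have Ct : coercive t (s *: (x *m x^T) + B).
  by apply: coerciveD => //; apply: psdmxZ => //; exact: psdmx_outer.
have CU := coercive_unit t0 Ct; have BU := coercive_unit t0 Bt.
suff CD : (s *: (x *m x^T) + B) *m (invmx B - k *: (u *m u^T)) = 1%:M.
  by rewrite -[LHS]mulmx1 -CD mulmxA mulVmx// mul1mx.
have Bu : B *m u = x by rewrite mulmxA mulmxV// mul1mx.
have xB : x^T *m invmx B = u^T.
  by rewrite trmx_mul (trmx_inv_coercive Bt).
rewrite mulmxDl !mulmxBr mulmxV// -!scalemxAl -!scalemxAr.
have -> : x *m x^T *m invmx B = x *m u^T by rewrite -mulmxA xB.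
have -> : x *m x^T *m (u *m u^T) = dotv x u *: (x *m u^T).
  by rewrite mulmxA outer_mulmx -scalemxAl.
have -> : B *m (u *m u^T) = x *m u^T by rewrite mulmxA Bu.
rewrite scalerA addrACA -[RHS]addr0 [_ + 1%:M]addrC -addrA; congr (_ + _).
rewrite scalerA -opprD -scalerDl -scalerBl.
by rewrite [X in X *: _](_ : _ = 0) ?scale0r// /k -/u; field.
Qed.

Lemma mxtrace_outer M x y : \tr (M *m (x *m y^T)) = dotv y (M *m x).
Proof. by rewrite mulmxA mxtrace_mulC /mxtrace big_ord1. Qed.

Lemma mxtrace_dotv M : \tr M = \sum_i dotv (delta_mx i 0) (M *m delta_mx i 0).
Proof.
apply: eq_bigr => i _; rewrite /dotv -colE trmx_delta -rowE.
by rewrite !mxE.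
Qed.

Lemma enorm_delta (i : 'I_p) : euclidean_norm (delta_mx i 0 : 'cV[R]_p) = 1.
Proof.
rewrite enormE /dotv trmx_delta mul_delta_mx mxE !eqxx sqrtr1 //.
Qed.

(** Each diagonal entry is a scalar product with a unit vector. *)
Lemma mxtrace_le M a :
  (forall x, euclidean_norm (M *m x) <= a * euclidean_norm x) ->
  `|\tr M| <= p%:R * a.
Proof.
move=> h; rewrite mxtrace_dotv; apply: le_trans (ler_norm_sum _ _ _) _.
have -> : p%:R * a = \sum_(i < p) a by rewrite sumr_const card_ord mulr_natl.
apply: ler_sum => i _; rewrite -[a]mul1r; apply: le_dotv.
  by rewrite enorm_delta.
by apply: le_trans (h _) _; rewrite enorm_delta mulr1.
Qed.

End linear_algebra.

(** * Real-valued expectations and measurable matrices *)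

Section expectation.
Context d (T : measurableType d) (R : realType) (P : probability T R).
Implicit Types (f g : T -> R).

Definition integrableR f := P.-integrable setT (EFin \o f).

Lemma measurable_integrableR f : integrableR f -> measurable_fun setT f.
Proof. by move=> /measurable_int/measurable_EFinP. Qed.

Lemma eq_integrableR f g : f =1 g -> integrableR f -> integrableR g.
Proof. by move=> /funext ->. Qed.

Lemma le_integrableR f g : measurable_fun setT f -> integrableR g ->
  (forall w, `|f w| <= g w) -> integrableR f.
Proof.
move=> mf ig fg; apply: le_integrable ig => //; first exact/measurable_EFinP.
by move=> w _; rewrite /= lee_fin (le_trans (fg w))// ler_norm.
Qed.

Lemma integrableR_cst (c : R) : integrableR (fun=> c).
Proof. exact: finite_measure_integrable_cst. Qed.

Lemma integrableR_bounded f (c : R) : measurable_fun setT f ->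
  (forall w, `|f w| <= c) -> integrableR f.
Proof. by move=> mf; apply: le_integrableR => //; exact: integrableR_cst. Qed.

Lemma integrableRD f g : integrableR f -> integrableR g ->
  integrableR (fun w => f w + g w).
Proof. by move=> fi gi; have := integrableD measurableT fi gi. Qed.

Lemma integrableRB f g : integrableR f -> integrableR g ->
  integrableR (fun w => f w - g w).
Proof. by move=> fi gi; have := integrableB measurableT fi gi. Qed.

Lemma integrableRZ (c : R) f : integrableR f -> integrableR (fun w => c * f w).
Proof. by move=> fi; have := integrableZl measurableT c fi. Qed.

Lemma integrableR_norm f : integrableR f -> integrableR (fun w => `|f w|).
Proof. exact: integrable_norm. Qed.

Lemma integrableR_sum I (r : seq I) (F : I -> T -> R) :
  (forall i, integrableR (F i)) -> integrableR (fun w => \sum_(i <- r) F i w).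
Proof.
move=> h; elim: r => [|i r ih].
  by under eq_fun do rewrite big_nil; exact: integrableR_cst.
by under eq_fun do rewrite big_cons; exact: integrableRD.
Qed.

Lemma Ex_cst (c : R) : \int[P]_w c = c.
Proof.
rewrite Rintegral_cst// [X in fine X](@probability_setT _ _ _ P : _ = 1%E).
by rewrite mulr1.
Qed.

Lemma ExD f g : integrableR f -> integrableR g ->
  \int[P]_w (f w + g w) = \int[P]_w f w + \int[P]_w g w.
Proof. by move=> fi gi; rewrite RintegralD. Qed.

Lemma ExB f g : integrableR f -> integrableR g ->
  \int[P]_w (f w - g w) = \int[P]_w f w - \int[P]_w g w.
Proof. by move=> fi gi; rewrite RintegralB. Qed.

Lemma ExZ (c : R) f : integrableR f ->
  \int[P]_w (c * f w) = c * \int[P]_w f w.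
Proof. by move=> fi; rewrite RintegralZl. Qed.

Lemma Ex_sum I (r : seq I) (F : I -> T -> R) :
  (forall i, integrableR (F i)) ->
  \int[P]_w (\sum_(i <- r) F i w) = \sum_(i <- r) \int[P]_w F i w.
Proof.
move=> h; elim: r => [|i r ih].
  by under eq_Rintegral do rewrite big_nil; rewrite Ex_cst big_nil.
under eq_Rintegral do rewrite big_cons.
by rewrite ExD ?big_cons ?ih//; exact: integrableR_sum.
Qed.

Lemma le_Ex f g : integrableR f -> integrableR g ->
  (forall w, f w <= g w) -> \int[P]_w f w <= \int[P]_w g w.
Proof. by move=> fi gi fg; apply: le_Rintegral. Qed.

Lemma Ex_ge0 f : (forall w, 0 <= f w) -> 0 <= \int[P]_w f w.
Proof. by move=> f0; apply: Rintegral_ge0. Qed.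

Lemma normr_Ex_le f g : integrableR f -> integrableR g ->
  (forall w, `|f w| <= g w) -> `|\int[P]_w f w| <= \int[P]_w g w.
Proof.
move=> fi gi fg; apply: le_trans (le_normr_Rintegral measurableT fi) _.
by apply: le_Ex => //; exact: integrableR_norm.
Qed.

Lemma eq_Ex f g : f =1 g -> \int[P]_w f w = \int[P]_w g w.
Proof. by move=> fg; apply: eq_Rintegral => w _. Qed.

Lemma integral_EFin_Ex f : integrableR f ->
  (\int[P]_w (f w)%:E)%E = (\int[P]_w f w)%:E.
Proof. by move=> fi; rewrite /Rintegral fineK// (integrable_fin_num measurableT fi). Qed.

Lemma ge0_integrableR f (c : R) : measurable_fun setT f ->
  (forall w, 0 <= f w) -> (\int[P]_w (f w)%:E = c%:E)%E -> integrableR f.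
Proof.
move=> mf f0 h; apply/integrableP; split; first exact/measurable_EFinP.
under eq_integral do rewrite /= ger0_norm//.
by rewrite h ltry.
Qed.

End expectation.

Section measurable_matrix.
Context d (T : measurableType d) (R : realType).

(** On positive numbers the inverse is [expR (- ln x)]. *)
Lemma measurable_funV_pos (f : T -> R) : measurable_fun setT f ->
  (forall w, 0 < f w) -> measurable_fun setT (fun w => (f w)^-1).
Proof.
move=> mf f0; rewrite (_ : (fun w => _) = (fun w => expR (- ln (f w)))).
  apply: (measurableT_comp (@measurable_expR R)).
  apply: measurable_funN.
  exact: (measurableT_comp (@measurable_ln R)).
by apply/funext => w; rewrite expRN lnK// posrE.
Qed.

(** Reduces to positive functions by [x^-1 = x * (x ^+ 2)^-1]. *)
Lemma measurable_funV_neq0 (f : T -> R) : measurable_fun setT f ->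
  (forall w, f w != 0) -> measurable_fun setT (fun w => (f w)^-1).
Proof.
move=> mf f0; rewrite (_ : (fun w => _) = (fun w => f w * (f w ^+ 2)^-1)).
  apply: measurable_funM => //; apply: measurable_funV_pos.
    exact: measurable_funX.
  by move=> w; rewrite exprn_even_gt0//= f0.
by apply/funext => w; rewrite expr2 invfM mulrA mulfV// mul1r.
Qed.

Definition measurable_mx m n (F : T -> 'M[R]_(m, n)) :=
  forall i j, measurable_fun setT (fun w => F w i j).

Lemma measurable_mx_cst m n (A : 'M[R]_(m, n)) : measurable_mx (fun=> A).
Proof. by move=> i j; exact: measurable_cst. Qed.

Lemma measurable_mxD m n (F G : T -> 'M[R]_(m, n)) :
  measurable_mx F -> measurable_mx G -> measurable_mx (fun w => F w + G w).
Proof.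
by move=> mF mG i j; under eq_fun do rewrite mxE; exact: measurable_funD.
Qed.

Lemma measurable_mxZ m n (f : T -> R) (F : T -> 'M[R]_(m, n)) :
  measurable_fun setT f -> measurable_mx F -> measurable_mx (fun w => f w *: F w).
Proof.
by move=> mf mF i j; under eq_fun do rewrite mxE; exact: measurable_funM.
Qed.

Lemma measurable_mx_tr m n (F : T -> 'M[R]_(m, n)) :
  measurable_mx F -> measurable_mx (fun w => (F w)^T).
Proof. by move=> mF i j; under eq_fun do rewrite mxE; exact: mF. Qed.

Lemma measurable_mxM m n q (F : T -> 'M[R]_(m, n)) (G : T -> 'M[R]_(n, q)) :
  measurable_mx F -> measurable_mx G -> measurable_mx (fun w => F w *m G w).
Proof.
move=> mF mG i j; under eq_fun do rewrite mxE.
by apply: measurable_sum => k; apply: measurable_funM.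
Qed.

Lemma measurable_mx_sum m n I (r : seq I) (F : I -> T -> 'M[R]_(m, n)) :
  (forall i, measurable_mx (F i)) -> measurable_mx (fun w => \sum_(i <- r) F i w).
Proof.
by move=> mF i j; under eq_fun do rewrite summxE; apply: measurable_sum => k; exact: mF.
Qed.

Lemma measurable_mxtrace n (F : T -> 'M[R]_n) :
  measurable_mx F -> measurable_fun setT (fun w => \tr (F w)).
Proof. by move=> mF; apply: measurable_sum => i. Qed.

Lemma measurable_det n (F : T -> 'M[R]_n) :
  measurable_mx F -> measurable_fun setT (fun w => \det (F w)).
Proof.
move=> mF; apply: measurable_sum => s.
apply: measurable_funM; first exact: measurable_cst.
by apply: measurable_prod => i _; exact: mF.
Qed.

(** By Cramer's rule the entries of the inverse are rational functions of the
    entries of the matrix. *)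
Lemma measurable_invmx n (F : T -> 'M[R]_n) : measurable_mx F ->
  (forall w, F w \in unitmx) -> measurable_mx (fun w => invmx (F w)).
Proof.
move=> mF uF i j; under eq_fun do rewrite /invmx uF !mxE.
apply: measurable_funM.
  apply: measurable_funV_neq0; first exact: measurable_det.
  by move=> w; rewrite -unitfE -unitmxE.
apply: measurable_funM; first exact: measurable_cst.
apply: measurable_det => k l; under eq_fun do rewrite !mxE.
exact: mF.
Qed.

Lemma measurable_dotv p (F G : T -> 'cV[R]_p) :
  measurable_mx F -> measurable_mx G ->
  measurable_fun setT (fun w => dotv (F w) (G w)).
Proof.
by move=> mF mG; apply: (measurable_mxM (measurable_mx_tr mF) mG).
Qed.

End measurable_matrix.

(** * Integration against a density *)

Section density.
Context d (T : measurableType d) (R : realType).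
Variables (mu nu : {measure set T -> \bar R}) (f : T -> R).
Hypotheses (mf : measurable_fun setT f) (f0 : forall x, 0 <= f x).
Hypothesis nuE : forall A, measurable A ->
  nu A = (\int[mu]_(x in A) (f x)%:E)%E.

Let integral_density_indic E : measurable E ->
  (\int[nu]_x (\1_E x)%:E = \int[mu]_x ((\1_E x)%:E * (f x)%:E))%E.
Proof.
move=> mE; rewrite integral_indic// setIT nuE// integral_mkcond/=.
apply: eq_integral => x _; rewrite patchE indicE.
by case: ifPn => xE; rewrite ?mul1e ?mul0e.
Qed.

Import HBNNSimple.

Let integral_density_nnsfun (g : {nnsfun T >-> R}) :
  (\int[nu]_x (g x)%:E = \int[mu]_x ((g x)%:E * (f x)%:E))%E.
Proof.
under [LHS]eq_integral do rewrite fimfunE -fsumEFin//.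
rewrite [LHS]ge0_integral_fsum//; last 2 first.
  - by move=> r; exact/measurable_EFinP/measurableT_comp.
  - by move=> n x _; rewrite EFinM nnfun_muleindic_ge0.
under [RHS]eq_integral.
  move=> x xD; rewrite fimfunE -fsumEFin// ge0_mule_fsuml; last first.
    by move=> r; rewrite EFinM nnfun_muleindic_ge0.
  over.
rewrite [RHS]ge0_integral_fsum//; last 2 first.
  - move=> r; apply: emeasurable_funM; last exact/measurable_EFinP.
    by apply/measurable_EFinP; do 2 apply/measurableT_comp => //.
  - move=> n x _; rewrite EFinM mule_ge0//; last by rewrite lee_fin.
    by rewrite nnfun_muleindic_ge0.
apply: eq_fsbigr => r _.
under [RHS]eq_integral do rewrite EFinM -muleA.
have [r0|r0] := leP 0 r.
  rewrite integralZl_indic_nnsfun// integral_density_indic// -ge0_integralZl//.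
  - by apply: emeasurable_funM; exact/measurable_EFinP.
  - by move=> x _; rewrite mule_ge0 ?lee_fin.
rewrite preimage_nnfun0// integral0_eq; last first.
  by move=> x _; rewrite indic0 mulr0.
by rewrite integral0_eq// => x _; rewrite indic0 mul0e mule0.
Qed.

(** Holds for indicators by assumption, then for simple functions by linearity,
    then in general by monotone convergence. *)
Lemma ge0_integral_density (g : T -> \bar R) :
  measurable_fun setT g -> (forall x, 0 <= g x)%E ->
  (\int[nu]_x g x = \int[mu]_x (g x * (f x)%:E))%E.
Proof.
move=> mg g0; pose g_ := nnsfun_approx measurableT mg.
have g_cvg x : (g_ n x)%:E @[n --> \oo] --> g x by exact: cvg_nnsfun_approx.
transitivity (lim (\int[nu]_x (g_ n x)%:E @[n --> \oo])%E).
  rewrite -monotone_convergence//=.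
  - by apply: eq_integral => x _; apply/esym/cvg_lim.
  - by move=> n; exact/measurable_EFinP/measurable_funTS.
  - by move=> n ? _; rewrite lee_fin.
  - by move=> ? _ ? ? mn; rewrite lee_fin; exact/lefP/nd_nnsfun_approx.
under eq_fun do rewrite integral_density_nnsfun.
rewrite -monotone_convergence//=.
- apply: eq_integral => x _; apply/cvg_lim => //.
  by apply: cvgeZr => //; exact: g_cvg.
- by move=> n; apply: emeasurable_funM; exact/measurable_EFinP.
- by move=> n x _; rewrite mule_ge0 ?lee_fin.
- move=> x _ m n mn; rewrite lee_wpmul2r ?lee_fin//.
  exact/lefP/nd_nnsfun_approx.
Qed.
End density.

(** * Moments of the centered normal density *)

Section halfline.
Context {R : realType} (s : R).
Hypothesis s0 : s != 0.
Local Notation mu := (@lebesgue_measure R).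
Local Notation phi := (normal_pdf 0 s).

Lemma normal_pdf0E x :
  phi x = normal_peak s * expR (- (2 * s ^+ 2)^-1 * x ^+ 2).
Proof.
rewrite normal_pdfE// /normal_fun subr0; congr (_ * expR _).
by rewrite -mulr_natl mulNr mulrC mulNr.
Qed.

(** The differential equation behind the recurrence for the moments. *)
Lemma is_derive_normal_pdf0 (x : R) :
  is_derive x 1 phi (- (x / s ^+ 2) * phi x).
Proof.
rewrite (_ : phi = fun x => normal_peak s * expR (- (2 * s ^+ 2)^-1 * x ^+ 2)).
  apply: is_derive_eq.
  rewrite /GRing.scale/=; field.
  by rewrite s0.
by apply/funext => y; rewrite normal_pdf0E.
Qed.

(** The term of degree [k.+1] in the exponential series already gives
    [expR (- y) <= k.+1`! / y ^+ k.+1], with [y = n ^+ 2 / (2 s ^+ 2)]; this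
    bounds the left-hand side by a constant times [1 / n]. *)
Lemma pow_normal_pdf0_cvg k : (n%:R ^+ k.+1 * phi n%:R) @[n --> \oo] --> (0 : R).
Proof.
pose c : R := (2 * s ^+ 2)^-1.
have c0 : 0 < c by rewrite invr_gt0 mulr_gt0// exprn_even_gt0.
pose K := normal_peak s * (k.+1`!%:R / c ^+ k.+1).
apply: (@squeeze_cvgr _ _ _ _ (cst 0) (fun n : nat => K / n%:R)).
- near=> n; have n0 : 0 < n%:R :> R by rewrite ltr0n; near: n; exists 1%N.
  have n1 : 1 <= n%:R :> R by rewrite ler1n -(ltr0n R).
  rewrite mulr_ge0 ?exprn_ge0 ?normal_pdf_ge0//=.
  rewrite normal_pdf0E -/c mulNr expRN /K mulrCA -!mulrA.
  rewrite ler_wpM2l ?normal_peak_ge0//.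
  have y0 : 0 <= c * n%:R ^+ 2 by rewrite mulr_ge0 ?sqr_ge0 ?(ltW c0).
  have := expR_ge1Dxn k y0.
  set e := expR _ => h.
  have e0 : 0 < e by exact: expR_gt0.
  have {}h : (c * n%:R ^+ 2) ^+ k.+1 <= k.+1`!%:R * e.
    rewrite [leRHS]mulrC -ler_pdivrMr ?ltr0n ?fact_gt0//.
    by apply: le_trans h; rewrite lerDr.
  rewrite ler_pdivrMr// -invfM mulrAC ler_pdivlMr ?mulr_gt0 ?exprn_gt0//.
  apply: le_trans h.
  rewrite exprMn mulrCA ler_pM2l ?exprn_gt0// -exprSr -exprM ler_weXn2l//.
  by rewrite mul2n -addnn addSn addnS !ltnS leq_addr.
- exact: cvg_cst.
- rewrite -cvg_shiftS.
  have := @cvgM _ _ _ _ (cst K) harmonic K 0 (cvg_cst K) cvg_harmonic.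
  by rewrite mulr0; exact.
Unshelve. all: by end_near. Qed.

Definition half_moment k := (\int[mu]_(x in `[0%R, +oo[) (`|x| ^+ k * phi x)%:E)%E.

Let cphi : continuous phi.
Proof. exact: continuous_normal_pdf. Qed.

Let half_moment_cvg k :
  (\int[mu]_(x in `[0%R, n%:R]) (`|x| ^+ k * phi x)%:E)%E @[n --> \oo]
  --> half_moment k.
Proof.
apply: ge0_cvgn_integral.
  by move=> x; rewrite mulr_ge0 ?exprn_ge0// normal_pdf_ge0.
apply: measurable_funM; last exact: measurable_normal_pdf.
by apply: measurable_funX; exact: normr_measurable.
Qed.

(** Integration by parts on [[0, n]], the function [x * phi x] being the
    derivative of [- s ^+ 2 * phi x]. *)
Let half_moment_itv k (n : nat) : (0 < n)%N ->
  (\int[mu]_(x in `[0%R, n%:R]) (`|x| ^+ k.+2 * phi x)%:E =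
   (- (s ^+ 2 * (n%:R ^+ k.+1 * phi n%:R)))%:E +
   (s ^+ 2 * k.+1%:R)%:E * \int[mu]_(x in `[0%R, n%:R]) (`|x| ^+ k * phi x)%:E)%E.
Proof.
move=> n0; have n0' : 0 < n%:R :> R by rewrite ltr0n.
have cX j : continuous (fun x : R => x ^+ j) by exact: exprn_continuous.
transitivity (\int[mu]_(x in `[0%R, n%:R]) (x ^+ k.+1 * (x * phi x))%:E)%E.
  apply: eq_integral => x; rewrite inE/= in_itv/= => /andP[x0 _].
  by rewrite ger0_norm// exprSr -mulrA.
rewrite (@integration_by_parts R (fun x => x ^+ k.+1) (fun x => - s ^+ 2 * phi x)
  (fun x => k.+1%:R * x ^+ k) (fun x => x * phi x))//.
- rewrite expr0n/= mul0r subr0 mulNr mulrN mulrCA; congr (_ + _)%E.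
  transitivity (- \int[mu]_(x in `[0%R, n%:R])
      (- ((s ^+ 2 * k.+1%:R)%:E * (`|x| ^+ k * phi x)%:E)))%E.
    congr (- _)%E; apply: eq_integral => x.
    rewrite inE/= in_itv/= => /andP[x0 _].
    by rewrite ger0_norm//; congr EFin; ring.
  have ge0 x : (0 <= (`|x| ^+ k * phi x)%:E)%E.
    by rewrite lee_fin mulr_ge0 ?exprn_ge0// normal_pdf_ge0.
  have c0 : (0 <= (s ^+ 2 * k.+1%:R)%:E)%E by rewrite lee_fin mulr_ge0 ?sqr_ge0.
  rewrite integral_ge0N; last by move=> x _; rewrite mule_ge0.
  rewrite oppeK ge0_integralZl//.
  apply/measurable_EFinP/measurable_funTS/measurable_funM.
    by apply: measurable_funX; exact: normr_measurable.
  exact: measurable_normal_pdf.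
- apply: continuous_subspaceT => x.
  by apply: cvgM; [exact: cvg_cst|exact: cX].
- split; last 2 first.
  + by apply: cvg_at_right_filter; exact: cX.
  + by apply: cvg_at_left_filter; exact: cX.
  + by move=> x _; exact: exprn_derivable.
- by move=> x _; rewrite exp_derive1.
- apply: continuous_subspaceT => x.
  by apply: cvgM; [exact: cvg_id|exact: cphi].
- have cs : continuous (fun x => - s ^+ 2 * phi x).
    by move=> x; apply: cvgM; [exact: cvg_cst|exact: cphi].
  split; last 2 first.
  + by apply: cvg_at_right_filter; exact: cs.
  + by apply: cvg_at_left_filter; exact: cs.
  + move=> x _; apply: derivableM; first exact: derivable_cst.
    exact: (@ex_derive _ _ _ _ _ _ _ (is_derive_normal_pdf0 x)).
- move=> x _; have dx := is_derive_normal_pdf0 x.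
  rewrite derive1Ml; last exact: (@ex_derive _ _ _ _ _ _ _ dx).
  rewrite derive1E (@derive_val _ _ _ _ _ _ _ dx); field.
  by rewrite s0.
Qed.

(** Limit of the integration by parts on bounded intervals: the boundary term
    vanishes at infinity. *)
Lemma half_moment_recur k : half_moment k \is a fin_num ->
  half_moment k.+2 = ((s ^+ 2 * k.+1%:R)%:E * half_moment k)%E.
Proof.
move=> hk; rewrite -(cvg_lim _ (@half_moment_cvg k.+2))//; apply/cvg_lim => //.
have h0 : - (s ^+ 2 * (n%:R ^+ k.+1 * phi n%:R)) @[n --> \oo] --> (0 : R).
  have h := cvgM (cvg_cst (s ^+ 2)) (@pow_normal_pdf0_cvg k).
  by have := cvgN (h _ _); rewrite mulr0 oppr0; exact.
have h1 : (- (s ^+ 2 * (n%:R ^+ k.+1 * phi n%:R)))%:E @[n --> \oo] --> 0%E.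
  by apply: cvg_EFin; [exact: nearW|exact: h0].
have h2 := cvgeZl (_ : (s ^+ 2 * k.+1%:R)%:E \is a fin_num) (@half_moment_cvg k).
rewrite -[X in _ --> X]add0e.
apply: (@cvg_trans _ ((fun n : nat => (- (s ^+ 2 * (n%:R ^+ k.+1 * phi n%:R)))%:E +
   (s ^+ 2 * k.+1%:R)%:E * \int[mu]_(x in `[0%R, n%:R]) (`|x| ^+ k * phi x)%:E)%E @ \oo)).
  apply: near_eq_cvg; near=> n; rewrite half_moment_itv//.
  by near: n; exists 1%N.
apply: cvgeD => //; last exact: h2.
Unshelve. all: by end_near. Qed.

Let abs_momentE k :
  (\int[mu]_x (`|x| ^+ k * phi x)%:E = 2%:E * half_moment k)%E.
Proof.
rewrite ge0_symfun_integralT//.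
- rewrite (_ : [set x | _] = `[0%R, +oo[%classic)//.
  by apply/seteqP; split => x/=; rewrite in_itv/= andbT.
- by move=> x; rewrite mulr_ge0 ?exprn_ge0// normal_pdf_ge0.
- move=> x; apply: cvgM; last exact: cphi.
  exact: (continuous_comp (@norm_continuous _ _ x) (@exprn_continuous _ k _)).
- by move=> x; rewrite /= normrN !normal_pdf0E sqrrN.
Qed.

(** Half of the total mass, by symmetry. *)
Lemma half_moment0 : half_moment 0 = (2^-1)%:E.
Proof.
have := abs_momentE 0; under eq_integral do rewrite expr0 mul1r.
rewrite integral_normal_pdf => h.
rewrite -[LHS]mul1e -[1%E](_ : (2^-1 * 2)%:E = _); last by rewrite mulVf.
by rewrite EFinM -muleA -h mule1.
Qed.

Lemma normal_moment2 : (\int[mu]_x (`|x| ^+ 2 * phi x)%:E = (s ^+ 2)%:E)%E.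
Proof.
rewrite abs_momentE half_moment_recur ?half_moment0// -!EFinM; congr EFin.
by field.
Qed.

Lemma normal_moment4 : (\int[mu]_x (`|x| ^+ 4 * phi x)%:E = (3 * s ^+ 4)%:E)%E.
Proof.
rewrite abs_momentE !half_moment_recur ?half_moment0// -!EFinM; congr EFin.
by field.
Qed.

End halfline.

(** * Moments of a Gaussian variable *)

Section gaussian_variable.
Context {R : realType}.
Local Notation mu := (@lebesgue_measure R).

Lemma ge0_integral_oppr (G : R -> R) : (forall x, 0 <= G x) -> continuous G ->
  (\int[mu]_x (G x)%:E = \int[mu]_x (G (- x))%:E)%E.
Proof.
move=> G0 cG.
have split_half (H : R -> R) : (forall x, 0 <= H x) -> continuous H ->
  (\int[mu]_x (H x)%:E = \int[mu]_(x in `[0%R, +oo[) (H x)%:E +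
    \int[mu]_(x in `[0%R, +oo[) (H (- x))%:E)%E.
  move=> H0 cH.
  have mH : measurable_fun [set: R] H by exact: continuous_measurable_fun.
  rewrite -(setUv `[0%R, +oo[%classic) ge0_integral_setU//= ; last 4 first.
    exact: measurableC.
    by apply/measurable_EFinP; rewrite setUv.
    by move=> x _; rewrite lee_fin.
    exact/disj_setPCl.
  congr (_ + _)%E; rewrite setCitvr.
  rewrite integral_itv_bndo_bndc; last exact/measurable_EFinP/measurable_funTS.
  rewrite -{1}oppr0 ge0_integration_by_substitutionNy//.
  exact: continuous_subspaceT.
have cGN : continuous (G \o -%R).
  move=> x; apply: continuous_comp; last exact: cG.
  by apply: cvgN; exact: cvg_id.
rewrite split_half// [RHS](split_half (G \o -%R))//; last by move=> x; exact: G0.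
rewrite addeC; congr (_ + _)%E.
by apply: eq_integral => x _; rewrite /= opprK.
Qed.

Lemma ge0_integral_normal_prob (m s : R) (G : R -> R) : s != 0 ->
  (forall x, 0 <= G x) -> continuous G ->
  (\int[normal_prob m s]_x (G (x - m))%:E =
   \int[mu]_x (G x * normal_pdf 0 s x)%:E)%E.
Proof.
move=> s0 G0 cG.
have cphi : continuous (normal_pdf 0 s) by exact: continuous_normal_pdf.
have cGm : continuous (fun x => G (x - m)).
  move=> x; apply: (continuous_comp (_ : {for x, continuous (fun x => x - m)})).
    by apply: cvgB; [exact: cvg_id|exact: cvg_cst].
  exact: cG.
have mGm : measurable_fun setT (fun x : R => (G (x - m))%:E).
  by apply/measurable_EFinP; exact: continuous_measurable_fun.
transitivity (\int[mu]_x ((G (x - m))%:E * (normal_pdf m s x)%:E))%E.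
  apply: (@ge0_integral_density _ _ _ mu (normal_prob m s) (normal_pdf m s)) => //.
  - exact: measurable_normal_pdf.
  - by move=> x; exact: normal_pdf_ge0.
  - by move=> x; rewrite lee_fin.
have dF : (fun x : R => x - m)^`()%classic = cst 1.
  apply/funext => x; rewrite derive1E deriveB// derive_id derive_cst subr0 //.
rewrite (@increasing_ge0_integration_by_substitutionT R (fun x => x - m)
  (fun x => G x * normal_pdf 0 s x)); rewrite ?dF.
- apply: eq_integral => x _; rewrite -EFinM; congr EFin.
  rewrite /= !fctE mulr1; congr (_ * _).
  by rewrite !normal_pdfE// /normal_fun subr0.
- by move=> x y xy; rewrite ltrD2r.
- by move=> x; exact: cvg_cst.
- exact: is_cvg_cst.
- exact: is_cvg_cst.
- by move=> x; apply: derivableB; [exact: derivable_id|exact: derivable_cst].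
- exact: cvg_addrr_Ny.
- exact: cvg_addrr.
- by move=> x; apply: cvgM; [exact: cG|exact: cphi].
- by move=> x; rewrite mulr_ge0// normal_pdf_ge0.
Qed.

Context d (T : measurableType d) (P : probability T R) (Y : T -> R) (m s : R).
Hypotheses (mY : measurable_fun setT Y)
  (lawY : forall B, measurable B -> P (Y @^-1` B) = gaussian_law m s B).

(** Transfers integrals of functions of [Y] to the density, treating the
    degenerate law separately. Non-negative functions are enough: they give the
    even moments directly, and the mean by a symmetry argument. *)
Let gaussian_integral (G : R -> R) : (forall x, 0 <= G x) -> continuous G ->
  (\int[P]_w (G (Y w - m))%:E =
  if s == 0%R then (G 0)%:E else \int[mu]_x (G x * normal_pdf 0 s x)%:E)%E.
Proof.
move=> G0 cG.
have cGm : continuous (fun x => G (x - m)).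
  move=> x; apply: (continuous_comp (_ : {for x, continuous (fun x => x - m)})).
    by apply: cvgB; [exact: cvg_id|exact: cvg_cst].
  exact: cG.
have mGm : measurable_fun setT (fun x : R => (G (x - m))%:E).
  by apply/measurable_EFinP; exact: continuous_measurable_fun.
have transfer (nu : {measure set (measurableTypeR R) -> \bar R}) :
    (forall B, measurable B -> P (Y @^-1` B) = nu B) ->
    (\int[P]_w (G (Y w - m))%:E = \int[nu]_y (G (y - m))%:E)%E.
  move=> nuE.
  rewrite -(@ge0_integral_pushforward _ _ T (measurableTypeR R) _ Y mY P setT
    (fun x => (G (x - m))%:E))//; last by move=> y _; rewrite lee_fin.
  by apply: eq_measure_integral => A mA _; exact: nuE.
case: ifPn => s0.
  rewrite (transfer (@dirac _ (measurableTypeR R) m R)); last first.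
    by move=> B mB; rewrite lawY// /gaussian_law s0.
  by rewrite integral_dirac// diracT mul1e subrr.
rewrite (transfer (normal_prob m s)); last first.
  by move=> B mB; rewrite lawY// /gaussian_law (negbTE s0).
exact: ge0_integral_normal_prob.
Qed.

Let mYm : measurable_fun setT (fun w => Y w - m).
Proof. by apply: measurable_funB => //; exact: measurable_cst. Qed.

Let sqrXnorm (x : R) : x ^+ 2 = `|x| ^+ 2.
Proof. by rewrite real_normK// num_real. Qed.

Let pow4norm (x : R) : x ^+ 4 = `|x| ^+ 4.
Proof. by rewrite -normrX ger0_norm// (exprM x 2 2) sqr_ge0. Qed.

Let gaussian_integral2 : (\int[P]_w ((Y w - m) ^+ 2)%:E = (s ^+ 2)%:E)%E.
Proof.
rewrite (gaussian_integral (G := fun x => x ^+ 2)); last 2 first.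
- by move=> x; exact: sqr_ge0.
- exact: exprn_continuous.
case: ifPn => [/eqP->//|s0]; rewrite -normal_moment2//.
by apply: eq_integral => x _; rewrite sqrXnorm.
Qed.

Let gaussian_integral4 : (\int[P]_w ((Y w - m) ^+ 4)%:E = (3 * s ^+ 4)%:E)%E.
Proof.
rewrite (gaussian_integral (G := fun x => x ^+ 4)); last 2 first.
- by move=> x; rewrite pow4norm exprn_ge0.
- exact: exprn_continuous.
case: ifPn => [/eqP->|s0]; first by rewrite !expr0n mulr0.
rewrite -normal_moment4//.
by apply: eq_integral => x _; rewrite pow4norm.
Qed.

Lemma gaussian_integrable4 : integrableR P (fun w => (Y w - m) ^+ 4).
Proof.
apply: ge0_integrableR gaussian_integral4; first exact: measurable_funX.
by move=> w; rewrite pow4norm exprn_ge0.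
Qed.

Lemma gaussian_integrable2 : integrableR P (fun w => (Y w - m) ^+ 2).
Proof.
apply: ge0_integrableR gaussian_integral2; first exact: measurable_funX.
by move=> w; rewrite sqr_ge0.
Qed.

Lemma gaussian_integrable1 : integrableR P (fun w => Y w - m).
Proof.
apply: le_integrableR (_ : integrableR P (fun w => 1 + (Y w - m) ^+ 2)) _ => //.
  by apply: integrableRD; [exact: integrableR_cst|exact: gaussian_integrable2].
by move=> w; rewrite ler_norml; have := sqr_ge0 (Y w - m - 1);
  have := sqr_ge0 (Y w - m + 1); nra.
Qed.

Lemma gaussian_Ex4 : \int[P]_w ((Y w - m) ^+ 4) = 3 * s ^+ 4.
Proof. by rewrite /Rintegral gaussian_integral4. Qed.

Lemma gaussian_Ex2 : \int[P]_w ((Y w - m) ^+ 2) = s ^+ 2.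
Proof. by rewrite /Rintegral gaussian_integral2. Qed.

(** By symmetry [1 + Z] and [1 - Z] have the same second moment, where
    [Z = Y - m]; the difference of these second moments is [4 E Z]. *)
Lemma gaussian_Ex1 : \int[P]_w (Y w - m) = 0.
Proof.
have c1 (c : R) : continuous (fun x => (1 + c * x) ^+ 2).
  have lin : continuous (fun x : R => 1 + c * x).
    move=> x; apply: cvgD; first exact: cvg_cst.
    by apply: cvgM; [exact: cvg_cst|exact: cvg_id].
  by move=> x; exact: (continuous_comp (lin x) (@exprn_continuous _ 2 _)).
have sym : (\int[P]_w ((1 + 1 * (Y w - m)) ^+ 2)%:E =
    \int[P]_w ((1 + -1 * (Y w - m)) ^+ 2)%:E)%E.
  rewrite (gaussian_integral (G := fun x => (1 + 1 * x) ^+ 2))//; last first.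
    by move=> x; exact: sqr_ge0.
  rewrite (gaussian_integral (G := fun x => (1 + -1 * x) ^+ 2))//; last first.
    by move=> x; exact: sqr_ge0.
  case: ifPn => [_|s0]; first by rewrite !mulr0.
  have cphi := continuous_normal_pdf s0.
  rewrite ge0_integral_oppr; last 2 first.
    by move=> x; rewrite mulr_ge0 ?sqr_ge0// normal_pdf_ge0.
    by move=> x; apply: cvgM; [exact: c1|exact: cphi].
  apply: eq_integral => x _; rewrite !normal_pdf0E// sqrrN mul1r mulN1r //.
have sq (c : R) : \int[P]_w ((1 + c * (Y w - m)) ^+ 2) =
    1 + c ^+ 2 * s ^+ 2 + 2 * c * \int[P]_w (Y w - m).
  under eq_Ex => w.
    rewrite (_ : _ ^+ 2 = 1 + c ^+ 2 * (Y w - m) ^+ 2 + 2 * c * (Y w - m));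
      last by ring.
    over.
  have i1 := gaussian_integrable1; have i2 := gaussian_integrable2.
  have i1' := integrableRZ (2 * c) i1; have i2' := integrableRZ (c ^+ 2) i2.
  have i0 := integrableR_cst P (1 : R).
  by rewrite (ExD (integrableRD i0 i2') i1') (ExD i0 i2') !ExZ// Ex_cst gaussian_Ex2.
have : \int[P]_w ((1 + 1 * (Y w - m)) ^+ 2) = \int[P]_w ((1 + -1 * (Y w - m)) ^+ 2).
  by rewrite /Rintegral sym.
rewrite !sq; lra.
Qed.

End gaussian_variable.

(** * Moments of a Gaussian vector *)

Section gaussian_vector_moments.
Context d (T : measurableType d) (R : realType) (P : probability T R) (p : nat)
  (X : {RV P >-> p.-tuple R}) (Sigma : 'M[R]_p).
Hypotheses (gaussX : gaussian_vector X) (meanX : centered X)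
  (covX : has_covariance X Sigma).
Local Notation lin u w := (dotv u (colv (X w))).

Lemma measurable_coord i : measurable_fun setT (fun w => tnth (X w) i).
Proof. exact: (measurableT_comp (measurable_tnth i) (measurable_funPT X)). Qed.

Lemma dotv_colv u w : dotv u (colv (X w)) = \sum_i u i 0 * tnth (X w) i.
Proof. by rewrite dotvE; apply: eq_bigr => i _; rewrite mxE. Qed.

Lemma dotv_delta (x : 'cV[R]_p) i : dotv (delta_mx i 0) x = x i 0.
Proof. by rewrite /dotv trmx_delta -rowE mxE. Qed.

Lemma measurable_lin u : measurable_fun setT (fun w => lin u w).
Proof.
under eq_fun do rewrite dotv_colv.
apply: measurable_sum => i; apply: measurable_funM; first exact: measurable_cst.
exact: measurable_coord.
Qed.

Lemma lin_delta i w : dotv (delta_mx i 0) (colv (X w)) = tnth (X w) i.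
Proof. by rewrite dotv_delta mxE. Qed.

Let integrable_lin u : integrableR P (fun w => lin u w).
Proof.
have [m [s law]] := gaussX u.
have := integrableRD (gaussian_integrable1 (measurable_lin u) law)
  (integrableR_cst P m).
by under eq_fun do rewrite subrK.
Qed.

Let Ex_lin u : \int[P]_w lin u w = 0.
Proof.
under eq_Ex do rewrite dotv_colv.
have int_coord i : integrableR P (fun w => tnth (X w) i).
  exact: eq_integrableR (lin_delta i) (integrable_lin _).
rewrite Ex_sum; last by move=> i; apply: integrableRZ.
rewrite big1// => i _; rewrite ExZ//.
have := meanX i; rewrite unlock => h.
by rewrite /Rintegral h mulr0.
Qed.

(** A linear form of the vector is Gaussian with mean zero, so all its moments
    are functions of one parameter [s]. *)
Let gaussian_lin u : exists s : R, [/\ integrableR P (fun w => lin u w ^+ 4),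
  integrableR P (fun w => lin u w ^+ 2), \int[P]_w lin u w ^+ 2 = s ^+ 2 &
  \int[P]_w lin u w ^+ 4 = 3 * s ^+ 4].
Proof.
have [m [s law]] := gaussX u; have ml := measurable_lin u.
have m0 : m = 0.
  have := gaussian_Ex1 ml law.
  rewrite (ExB (integrable_lin u) (integrableR_cst P m)) Ex_lin Ex_cst sub0r.
  by move/eqP; rewrite oppr_eq0 => /eqP.
have lE w : lin u w - m = lin u w by rewrite m0 subr0.
exists s; split.
- by apply: eq_integrableR (gaussian_integrable4 ml law) => w; rewrite lE.
- by apply: eq_integrableR (gaussian_integrable2 ml law) => w; rewrite lE.
- by rewrite -(gaussian_Ex2 ml law); apply: eq_Ex => w; rewrite lE.
- by rewrite -(gaussian_Ex4 ml law); apply: eq_Ex => w; rewrite lE.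
Qed.

Lemma integrable_lin_pow4 u : integrableR P (fun w => lin u w ^+ 4).
Proof. by have [s []] := gaussian_lin u. Qed.

Lemma integrable_lin_sqr u : integrableR P (fun w => lin u w ^+ 2).
Proof. by have [s []] := gaussian_lin u. Qed.

Lemma integrable_linM u v : integrableR P (fun w => lin u w * lin v w).
Proof.
apply: le_integrableR (integrableRD (integrable_lin_sqr u) (integrable_lin_sqr v)) _.
  by apply: measurable_funM; exact: measurable_lin.
move=> w /=; rewrite ler_norml.
have := sqr_ge0 (lin u w - lin v w); have := sqr_ge0 (lin u w + lin v w).
by move: (lin u w) (lin v w) => a b; nra.
Qed.

Lemma cov_sym : Sigma^T = Sigma.
Proof.
apply/matrixP => i k; rewrite mxE; have := covX k i.
by rewrite covarianceC covX => -[].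
Qed.

Lemma Ex_linM u v : \int[P]_w (lin u w * lin v w) = dotv u (Sigma *m v).
Proof.
have Ecoord i k : \int[P]_w (tnth (X w) i * tnth (X w) k) = Sigma i k.
  have := covX i k; rewrite unlock !meanX/= unlock => h.
  rewrite /Rintegral (_ : (\int[P]_w _)%E = (Sigma i k)%:E)// -h.
  by apply: eq_integral => w _; congr EFin; rewrite !fctE/= !subr0.
under eq_Ex => w.
  rewrite !dotv_colv mulr_suml.
  under eq_bigr do rewrite mulr_sumr.
  over.
have iM i k : integrableR P (fun w => u i 0 * tnth (X w) i * (v k 0 * tnth (X w) k)).
  apply: eq_integrableR (integrableRZ (u i 0 * v k 0)
    (integrable_linM (delta_mx i 0) (delta_mx k 0))) => w.
  by rewrite !lin_delta mulrACA.
rewrite Ex_sum; last by move=> i; apply: integrableR_sum => k; exact: iM.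
rewrite dotvE; apply: eq_bigr => i _; rewrite Ex_sum; last by move=> k; exact: iM.
rewrite mxE mulr_sumr; apply: eq_bigr => k _.
rewrite -Ecoord (mulrC _ (v k 0)) mulrA -ExZ; last first.
  apply: eq_integrableR (integrable_linM (delta_mx i 0) (delta_mx k 0)) => w.
  by rewrite !lin_delta.
by apply: eq_Ex => w; rewrite mulrACA.
Qed.

Lemma psdmx_cov : psdmx Sigma.
Proof.
split=> [|x]; first exact: cov_sym.
by rewrite -Ex_linM Ex_ge0// => w; rewrite -expr2 sqr_ge0.
Qed.

Lemma Ex_lin_pow4 u : \int[P]_w lin u w ^+ 4 = 3 * dotv u (Sigma *m u) ^+ 2.
Proof.
rewrite -Ex_linM; have [s [_ _ h2 ->]] := gaussian_lin u.
rewrite (_ : \int[P]_w _ = s ^+ 2); first by rewrite -exprM.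
by rewrite -h2; apply: eq_Ex => w; rewrite expr2.
Qed.

Lemma integrable_lin4 a b c e :
  integrableR P (fun w => lin a w * lin b w * lin c w * lin e w).
Proof.
apply: le_integrableR (integrableRD
  (integrableRD (integrable_lin_pow4 a) (integrable_lin_pow4 b))
  (integrableRD (integrable_lin_pow4 c) (integrable_lin_pow4 e))) _.
  by repeat apply: measurable_funM; exact: measurable_lin.
have amgm (x y : R) : `|x * y| <= (x ^+ 2 + y ^+ 2) / 2.
  rewrite ler_norml; have := sqr_ge0 (x - y); have := sqr_ge0 (x + y); nra.
move=> w; rewrite -mulrA.
move: (lin a w) (lin b w) (lin c w) (lin e w) => x y z t.
apply: le_trans (amgm _ _) _.
have h1 := amgm (x ^+ 2) (y ^+ 2); have h2 := amgm (z ^+ 2) (t ^+ 2).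
have {}h1 := le_trans (ler_norm _) h1; have {}h2 := le_trans (ler_norm _) h2.
have p4 (q : R) : q ^+ 4 = (q ^+ 2) ^+ 2 by rewrite -exprM.
rewrite !exprMn !p4; have := sqr_ge0 (x ^+ 2); have := sqr_ge0 (y ^+ 2).
have := sqr_ge0 (z ^+ 2); have := sqr_ge0 (t ^+ 2); lra.
Qed.

(** Fourth moments of linear forms determine the expectation of a product of
    four linear forms, by the polarization identity that expresses [192 x y z t]
    as the signed sum of the eight fourth powers [(x +- y +- z +- t) ^ 4]. *)
Lemma isserlis a b c e :
  \int[P]_w (lin a w * lin b w * lin c w * lin e w) =
  dotv a (Sigma *m b) * dotv c (Sigma *m e) +
  dotv a (Sigma *m c) * dotv b (Sigma *m e) +
  dotv a (Sigma *m e) * dotv b (Sigma *m c).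
Proof.
pose L u := \int[P]_w lin u w ^+ 4.
have symS x y : dotv y (Sigma *m x) = dotv x (Sigma *m y).
  by rewrite dotv_mulmx cov_sym dotvC.
have LE u : L u = 3 * dotv u (Sigma *m u) ^+ 2 := Ex_lin_pow4 u.
have i4 := integrable_lin_pow4.
have ExL (c0 : R) (f1 f2 f3 f4 g1 g2 g3 g4 : T -> R) :
    integrableR P f1 -> integrableR P f2 -> integrableR P f3 -> integrableR P f4 ->
    integrableR P g1 -> integrableR P g2 -> integrableR P g3 -> integrableR P g4 ->
    \int[P]_w (c0 * ((f1 w + f2 w) + ((f3 w + f4 w) -
      ((g1 w + g2 w) + (g3 w + g4 w))))) =
    c0 * ((\int[P]_w f1 w + \int[P]_w f2 w) + ((\int[P]_w f3 w + \int[P]_w f4 w) -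
      ((\int[P]_w g1 w + \int[P]_w g2 w) + (\int[P]_w g3 w + \int[P]_w g4 w)))).
  move=> h1 h2 h3 h4 k1 k2 k3 k4.
  have h12 := integrableRD h1 h2; have h34 := integrableRD h3 h4.
  have k12 := integrableRD k1 k2; have k34 := integrableRD k3 k4.
  have k := integrableRD k12 k34; have hk := integrableRB h34 k.
  rewrite (ExZ _ (integrableRD h12 hk)) (ExD h12 hk) (ExD h1 h2) (ExB h34 k).
  by rewrite (ExD h3 h4) (ExD k12 k34) (ExD k1 k2) (ExD k3 k4).
transitivity (192^-1 * (
   (L (a + b + c + e) + L (a + b - c - e)) +
   ((L (a - b + c - e) + L (a - b - c + e)) -
   ((L (a + b + c - e) + L (a + b - c + e)) +
   (L (a - b + c + e) + L (a - b - c - e)))))).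
  rewrite -(ExL _ _ _ _ _ _ _ _ _ (i4 _) (i4 _) (i4 _) (i4 _) (i4 _) (i4 _)
    (i4 _) (i4 _)).
  apply: eq_Ex => w; rewrite !(dotvDl, dotvNl).
  move: (dotv a _) (dotv b _) (dotv c _) (dotv e _) => x y z t.
  by field.
rewrite !LE !(mulmxDr, mulmxN) !(dotvDl, dotvNl, dotvDr, dotvNr).
rewrite (symS a b) (symS a c) (symS a e) (symS b c) (symS b e) (symS c e).
by field.
Qed.
End gaussian_vector_moments.

(** * Quadratic forms in a Gaussian vector *)

Section quadratic_forms.
Context d (T : measurableType d) (R : realType) (P : probability T R) (p : nat)
  (X : {RV P >-> p.-tuple R}) (Sigma : 'M[R]_p).
Hypotheses (gaussX : gaussian_vector X) (meanX : centered X)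
  (covX : has_covariance X Sigma).
Local Notation lin u w := (dotv u (colv (X w))).
Local Notation q M w := (dotv (colv (X w)) (M *m colv (X w))).
Local Notation e i := (delta_mx i 0 : 'cV[R]_p).

(** Expressing the quadratic form through linear forms is what makes
    [isserlis] applicable to it and to its square. *)
Lemma quad_lin M w : M^T = M -> q M w = \sum_i (lin (e i) w * lin (M *m e i) w).
Proof.
move=> tM; rewrite dotvE; apply: eq_bigr => i _.
by rewrite -[M in dotv (M *m delta_mx _ _)]tM -dotv_mulmx !dotv_delta.
Qed.

Lemma integrable_quad M : M^T = M -> integrableR P (fun w => q M w).
Proof.
move=> tM; apply: eq_integrableR (fun w => esym (quad_lin w tM)) _.
by apply: integrableR_sum => i; exact: (integrable_linM gaussX meanX).
Qed.

Lemma Ex_quad M : M^T = M -> \int[P]_w q M w = \tr (Sigma *m M).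
Proof.
move=> tM; under eq_Ex do rewrite quad_lin//.
rewrite Ex_sum; last by move=> i; exact: (integrable_linM gaussX meanX).
apply: eq_bigr => i _; rewrite (Ex_linM gaussX meanX covX) mulmxA.
by rewrite dotv_delta -colE mxE.
Qed.

Let quad_sqr M w : M^T = M ->
  q M w ^+ 2 = \sum_i \sum_j
    (lin (e i) w * lin (M *m e i) w * lin (e j) w * lin (M *m e j) w).
Proof.
move=> tM; rewrite expr2 quad_lin// mulr_suml; apply: eq_bigr => i _.
by rewrite mulr_sumr; apply: eq_bigr => j _; rewrite !mulrA.
Qed.

Lemma integrable_quad_sqr M : M^T = M -> integrableR P (fun w => q M w ^+ 2).
Proof.
move=> tM; apply: eq_integrableR (fun w => esym (quad_sqr w tM)) _.
apply: integrableR_sum => i; apply: integrableR_sum => j.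
exact: (integrable_lin4 gaussX meanX).
Qed.

Let dotv_deltaM (N : 'M[R]_p) i j : dotv (e i) (N *m e j) = N i j.
Proof. by rewrite dotv_delta -colE mxE. Qed.

(** Of the three pairings in [isserlis], one gives the square of the mean and the
    other two give equal traces. *)
Lemma Ex_quad_sqr M : M^T = M -> \int[P]_w q M w ^+ 2 =
  \tr (Sigma *m M) ^+ 2 + 2 * \tr (Sigma *m M *m (Sigma *m M)).
Proof.
move=> tM; under eq_Ex do rewrite quad_sqr//.
have i4 := integrable_lin4 gaussX meanX.
rewrite Ex_sum; last by move=> i; apply: integrableR_sum => j; exact: i4.
have ME N i j : dotv (M *m e i) (N *m e j) = (M *m N) i j.
  by rewrite -[in LHS]tM -dotv_mulmx mulmxA dotv_deltaM.
have SM : (Sigma *m M)^T = M *m Sigma by rewrite trmx_mul tM (cov_sym covX).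
pose S := Sigma *m M.
have SMS : (M *m S)^T = M *m S by rewrite trmx_mul SM tM mulmxA.
have E1 i j : dotv (e i) (Sigma *m (M *m e j)) = S i j.
  by rewrite mulmxA dotv_deltaM.
have E2 i j : dotv (M *m e i) (Sigma *m (M *m e j)) = (M *m S) j i.
  by rewrite mulmxA ME -[in LHS]SMS mxE.
have E3 i j : dotv (M *m e i) (Sigma *m e j) = S j i by rewrite ME -SM mxE.
transitivity (\sum_i \sum_j (S i i * S j j + Sigma i j * (M *m S) j i + S i j * S j i)).
  apply: eq_bigr => i _; rewrite Ex_sum; last by move=> j; exact: i4.
  apply: eq_bigr => j _; rewrite (isserlis gaussX meanX covX).
  by rewrite !E1 dotv_deltaM E2 E3.
under eq_bigr do rewrite !big_split/=.
rewrite !big_split/= -addrA; congr (_ + _).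
  by rewrite expr2 mulr_suml; apply: eq_bigr => i _; rewrite mulr_sumr.
rewrite mulr_natl mulr2n; congr (_ + _); apply: eq_bigr => i _.
  by rewrite -/S -(mulmxA Sigma M) mxE.
by rewrite -/S mxE.
Qed.

(** The variance of the quadratic form plus the square of a bias. The reference
    value [c] is arbitrary because it will be a mean over the whole sample, and
    not over this vector only. *)
Lemma Ex_quadB_sqr M c : M^T = M -> \int[P]_w (q M w - c) ^+ 2 =
  2 * \tr (Sigma *m M *m (Sigma *m M)) + (\tr (Sigma *m M) - c) ^+ 2.
Proof.
move=> tM; have i2 := integrable_quad_sqr tM.
have i1 := integrableRZ (- (2 * c)) (integrable_quad tM).
have i0 := integrableR_cst P (c ^+ 2).
under eq_Ex => w.
  rewrite (_ : _ ^+ 2 = q M w ^+ 2 + - (2 * c) * q M w + c ^+ 2); last by ring.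
  over.
rewrite (ExD (integrableRD i2 i1) i0) (ExD i2 i1) ExZ; last exact: integrable_quad.
by rewrite Ex_cst Ex_quad// Ex_quad_sqr//; ring.
Qed.

(** The trace is the mean of a non-negative quadratic form. *)
Lemma mxtrace_cov_psd_ge0 M : psdmx M -> 0 <= \tr (Sigma *m M).
Proof. by move=> [tM M0]; rewrite -Ex_quad// Ex_ge0. Qed.

Section operator_bound.
Variable sg : R.
Hypothesis Sle : forall x, euclidean_norm (Sigma *m x) <= sg * euclidean_norm x.
Hypothesis sg0 : 0 <= sg.

Lemma dotv_cov_le x y :
  `|dotv x (Sigma *m y)| <= sg * (euclidean_norm x * euclidean_norm y).
Proof.
apply: le_trans (cauchy_schwarz _ _) _.
by rewrite mulrCA ler_wpM2l// enorm_ge0.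
Qed.

(** The Cauchy-Schwarz inequality, obtained from
    [x y <= l x^2 / 2 + y^2 / (2 l)] with [l] the quotient of the norms. *)
Lemma Ex_normM_le a b :
  \int[P]_w `|lin a w * lin b w| <= sg * (euclidean_norm a * euclidean_norm b).
Proof.
have ge0 (x : 'cV[R]_p) := enorm_ge0 x.
have [->|a0] := eqVneq a 0.
  under eq_Ex do rewrite dotvC dotv0r mul0r normr0.
  by rewrite Ex_cst enorm0 ?mul0r ?mulr0.
have [->|b0] := eqVneq b 0.
  under eq_Ex do rewrite (dotvC 0) dotv0r mulr0 normr0.
  by rewrite Ex_cst enorm0 ?mul0r ?mulr0.
have nz (c : 'cV[R]_p) : c != 0 -> 0 < euclidean_norm c.
  by move=> c0; rewrite lt_def ge0 andbT; apply: contra c0 => /eqP/enorm_eq0->.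
have {a0}a0 := nz _ a0; have {b0}b0 := nz _ b0.
set na := euclidean_norm a in a0 *; set nb := euclidean_norm b in b0 *.
have ia := integrable_linM gaussX meanX a a.
have ib := integrable_linM gaussX meanX b b.
pose l := nb / na; have l0 : 0 < l by rewrite divr_gt0.
apply: (@le_trans _ _ (\int[P]_w (l / 2 * (lin a w * lin a w) +
    (l^-1 / 2) * (lin b w * lin b w)))).
  apply: le_Ex; first exact/integrableR_norm/integrable_linM.
    by apply: integrableRD; exact: integrableRZ.
  move=> w; move: (lin a w) (lin b w) => x y.
  have h (z : R) : z * y <= l / 2 * (z * z) + l^-1 / 2 * (y * y).
    have : 0 <= (l * z - y) ^+ 2 / (2 * l) by rewrite divr_ge0 ?sqr_ge0// mulr_ge0 ?ltW.
    rewrite (_ : (l * z - y) ^+ 2 / (2 * l) =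
      l / 2 * (z * z) + l^-1 / 2 * (y * y) - z * y) ?subr_ge0//.
    by field; rewrite gt_eqF.
  rewrite ler_norml h andbT; have := h (- x); rewrite mulrNN !mulNr; lra.
rewrite ExD ?ExZ ?(Ex_linM gaussX meanX covX)//; try exact: integrableRZ.
have := dotv_cov_le a a; have := dotv_cov_le b b; rewrite -/na -/nb.
move=> /(le_trans (ler_norm _)) hb /(le_trans (ler_norm _)) ha.
apply: (@le_trans _ _ (l / 2 * (sg * (na * na)) + l^-1 / 2 * (sg * (nb * nb)))).
  by rewrite lerD// ler_wpM2l// divr_ge0// ?invr_ge0 ltW.
rewrite le_eqVlt; apply/orP; left; apply/eqP; rewrite /l; field.
by rewrite !gt_eqF.
Qed.

Lemma Ex_sqrM_le a b : \int[P]_w (lin a w * lin b w) ^+ 2 <=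
  3 * (sg * (euclidean_norm a * euclidean_norm b)) ^+ 2.
Proof.
rewrite (_ : Rintegral _ _ _ = \int[P]_w (lin a w * lin a w * lin b w * lin b w)).
  rewrite (isserlis gaussX meanX covX).
  have := dotv_cov_le a a; have := dotv_cov_le b b; have := dotv_cov_le a b.
  set na := euclidean_norm a; set nb := euclidean_norm b.
  have na0 : 0 <= na by exact: enorm_ge0.
  have nb0 : 0 <= nb by exact: enorm_ge0.
  move=> hab hb ha.
  have h1 := ler_pM (normr_ge0 _) (normr_ge0 _) ha hb.
  have h2 := ler_pM (normr_ge0 _) (normr_ge0 _) hab hab.
  have := ler_norm (dotv a (Sigma *m a) * dotv b (Sigma *m b)).
  have := ler_norm (dotv a (Sigma *m b) * dotv a (Sigma *m b)).
  rewrite (_ : sg * (na * na) * _ = (sg * (na * nb)) ^+ 2) in h1; last by ring.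
  rewrite -expr2 in h2; rewrite !normrM; lra.
by apply: eq_Ex => w; ring.
Qed.

End operator_bound.
End quadratic_forms.

(** * Adding one vector to the resolvent *)

Lemma inv1D_dist (R : realFieldType) (s a b : R) : 0 <= s -> 0 <= a -> 0 <= b ->
  `|(1 + s * a)^-1 - (1 + s * b)^-1| <= Num.min 1 (s * `|a - b|).
Proof.
move=> s0 a0 b0.
have sa : 1 <= 1 + s * a by rewrite lerDl mulr_ge0.
have sb : 1 <= 1 + s * b by rewrite lerDl mulr_ge0.
have ua : 0 <= (1 + s * a)^-1 <= 1.
  by rewrite invr_ge0 (le_trans ler01 sa) invf_le1// (lt_le_trans ltr01).
have ub : 0 <= (1 + s * b)^-1 <= 1.
  by rewrite invr_ge0 (le_trans ler01 sb) invf_le1// (lt_le_trans ltr01).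
rewrite le_min; apply/andP; split; first by rewrite ler_norml; lra.
rewrite (_ : _ - _ = s * (b - a) * ((1 + s * a)^-1 * (1 + s * b)^-1)); last first.
  by field; rewrite !gt_eqF// (lt_le_trans ltr01).
rewrite normrM normrM (ger0_norm s0) distrC ler_piMr ?mulr_ge0//.
rewrite normrM !ger0_norm; [|lra|lra].
by case/andP: ua => *; case/andP: ub => *; rewrite mulr_ile1.
Qed.

Section rank_one_resolvent.
Context (R : realType) (p : nat) (t : R) (B Sigma : 'M[R]_p).
Hypotheses (t0 : 0 < t) (Bt : coercive t B).
Implicit Types (x v u y : 'cV[R]_p) (s g : R).

Lemma invmx_update_dotv s x v y : 0 <= s ->
  dotv v (invmx (s *: (x *m x^T) + B) *m y) =
  dotv v (invmx B *m y) - s / (1 + s * dotv x (invmx B *m x)) *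
    (dotv (invmx B *m v) x * dotv (invmx B *m y) x).
Proof.
move=> s0; rewrite (sherman_morrison _ t0 Bt s0) mulmxBl dotvBr -scalemxAl dotvZr.
rewrite outer_mulmx dotvZr; congr (_ - _ * _).
rewrite mulrC dotv_mulmx (trmx_inv_coercive Bt); congr (_ * _).
by rewrite [RHS]dotvC [RHS]dotv_mulmx (trmx_inv_coercive Bt).
Qed.

Lemma invmx_update_dotv_self s x v : 0 <= s ->
  dotv v (invmx (s *: (x *m x^T) + B) *m x) =
  dotv (invmx B *m v) x / (1 + s * dotv x (invmx B *m x)).
Proof.
move=> s0; have [_ /(_ x) q0] := psdmx_inv_coercive t0 Bt.
rewrite invmx_update_dotv// (dotvC (_ *m x)) (dotv_mulmx _ v).
rewrite (trmx_inv_coercive Bt).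
by field; rewrite gt_eqF// ltr_pwDl// mulr_ge0.
Qed.

Lemma mxtrace_invmx_update s x : 0 <= s ->
  \tr (Sigma *m invmx (s *: (x *m x^T) + B)) = \tr (Sigma *m invmx B) -
  s / (1 + s * dotv x (invmx B *m x)) *
    dotv (invmx B *m x) (Sigma *m (invmx B *m x)).
Proof.
move=> s0; rewrite (sherman_morrison _ t0 Bt s0) mulmxBr linearB /=.
by rewrite -scalemxAr linearZ /= mxtrace_outer.
Qed.

(** The bound is uniform in [s] and [x]: the numerator
    [s y^T Sigma y <= s sigma |y|^2], with [y = invmx B *m x], is at most
    [(sigma / t) s x^T y] by coercivity, and the denominator is [1 + s x^T y]. *)
Lemma mxtrace_invmx_update_dist s x sg : 0 <= s -> psdmx Sigma -> 0 <= sg ->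
  (forall y, euclidean_norm (Sigma *m y) <= sg * euclidean_norm y) ->
  `|\tr (Sigma *m invmx (s *: (x *m x^T) + B)) - \tr (Sigma *m invmx B)| <= sg / t.
Proof.
move=> s0 [_ S0] sg0 Sle; rewrite mxtrace_invmx_update// addrAC subrr sub0r normrN.
have [_ /(_ x) q0] := psdmx_inv_coercive t0 Bt.
have h := dotv_inv_coercive t0 Bt x.
set y := invmx B *m x in h q0 *; have y0 := S0 y.
have d0 : 0 < 1 + s * dotv x y by rewrite ltr_pwDl// mulr_ge0.
rewrite ger0_norm; last by rewrite mulr_ge0// divr_ge0// ltW.
have h2 : dotv y (Sigma *m y) <= sg * dotv y y.
  apply: le_trans (ler_norm _) _; apply: le_trans (cauchy_schwarz _ _) _.
  by rewrite -sqr_enorm expr2 mulrCA ler_wpM2l// enorm_ge0.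
have h3 : dotv y (Sigma *m y) <= sg / t * dotv x y.
  apply: (le_trans h2); rewrite -mulrA ler_wpM2l//.
  by rewrite mulrC ler_pdivlMr// mulrC.
have sgt : 0 <= sg / t by rewrite divr_ge0// ltW.
rewrite mulrAC ler_pdivrMr//.
apply: (le_trans (ler_wpM2l s0 h3)); rewrite mulrCA ler_wpM2l//.
by rewrite lerDr.
Qed.

Lemma enorm_inv_le y a : euclidean_norm y <= a ->
  euclidean_norm (invmx B *m y) <= a / t.
Proof.
move=> h; apply: le_trans (enorm_inv_coercive t0 Bt y) _.
by rewrite ler_wpM2r// invr_ge0 ltW.
Qed.

End rank_one_resolvent.

(** One term of the resolvent identity: [Q] is the resolvent of the sample, [x]
    one of its vectors and [s] the weight of that vector; [a] stands for the mean
    of the trace and [u] for the deterministic resolvent applied to [v]. *)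
Definition resolvent_residual (R : realType) (p : nat) (Sigma : 'M[R]_p)
    (s a : R) (v u : 'cV[R]_p) (Q : 'M[R]_p) (x : 'cV[R]_p) : R :=
  (1 + s * a)^-1 * dotv v (Q *m (Sigma *m u)) - dotv v (Q *m x) * dotv x u.

Section one_vector_step.
Context d (T : measurableType d) (R : realType) (P : probability T R) (p : nat)
  (X : {RV P >-> p.-tuple R}) (Sigma : 'M[R]_p).
Hypotheses (gaussX : gaussian_vector X) (meanX : centered X)
  (covX : has_covariance X Sigma).
Variables (t sg : R) (B : 'M[R]_p).
Hypotheses (t0 : 0 < t) (Bt : coercive t B) (sg0 : 0 <= sg).
Hypothesis Sle : forall x, euclidean_norm (Sigma *m x) <= sg * euclidean_norm x.
Variables (s a : R) (v u : 'cV[R]_p).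
Hypotheses (s0 : 0 <= s) (a0 : 0 <= a) (v1 : euclidean_norm v <= 1)
  (ut : euclidean_norm u <= 1 / t).

Local Notation residual Q x := (resolvent_residual Sigma s a v u Q x).

Let M := invmx B.
Let xi w := colv (X w).
Let q w := dotv (xi w) (M *m xi w).
Let g := (1 + s * a)^-1.
Let h w := (1 + s * q w)^-1.
Let al w := dotv (M *m v) (xi w).
Let be w := dotv u (xi w).
Let be' w := dotv (M *m (Sigma *m u)) (xi w).
Let D w := al w * be w * (g - h w) - g * (s * h w * (al w * be' w)).
Let Q w := invmx (s *: (xi w *m (xi w)^T) + B).

Let psdM : psdmx M. Proof. exact: psdmx_inv_coercive Bt. Qed.
Let q0 w : 0 <= q w. Proof. by have [_] := psdM; apply. Qed.

Let Qt w : coercive t (s *: (xi w *m (xi w)^T) + B).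
Proof. by apply: coerciveD => //; apply: psdmxZ => //; exact: psdmx_outer. Qed.

(** The part that has expectation zero is split off; what is left, [D], is small
    for two different reasons, [D_le1] and [D_le2]. *)
Let residualE w : residual (Q w) (xi w) =
  g * (dotv v (M *m (Sigma *m u)) - al w * be w) + D w.
Proof.
rewrite /resolvent_residual (invmx_update_dotv_self t0 Bt)//.
rewrite (invmx_update_dotv t0 Bt)// (dotvC _ u) -/M -/(al w) -/(be w) -/(be' w) -/g.
rewrite /D /h -/(q w); ring.
Qed.

Let measurable_xi : measurable_mx xi.
Proof.
move=> i j; under eq_fun do rewrite mxE; exact: measurable_coord.
Qed.

Let measurable_q : measurable_fun setT q.
Proof.
by apply: measurable_dotv => //; apply: measurable_mxM => //; exact: measurable_mx_cst.
Qed.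

Let measurable_h : measurable_fun setT h.
Proof.
apply: measurable_funV_pos.
  apply: measurable_funD; first exact: measurable_cst.
  by apply: measurable_funM; [exact: measurable_cst|exact: measurable_q].
by move=> w; rewrite ltr_pwDl// mulr_ge0.
Qed.

Let measurable_D : measurable_fun setT D.
Proof.
have ml c : measurable_fun setT (fun w => dotv c (xi w)) by exact: measurable_lin.
have mc (c : R) : measurable_fun setT (fun w : T => c) by exact: measurable_cst.
have mal : measurable_fun setT al by exact: ml.
have mbe : measurable_fun setT be by exact: ml.
have mbe' : measurable_fun setT be' by exact: ml.
apply: measurable_funB.
  by apply: measurable_funM; [exact: measurable_funM|exact: measurable_funB].
by do !apply: measurable_funM.
Qed.

Let h01 w : 0 <= h w <= 1.
Proof.
have d1 : 1 <= 1 + s * q w by rewrite lerDl mulr_ge0.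
by rewrite invr_ge0 (le_trans ler01 d1) invf_le1// (lt_le_trans ltr01).
Qed.

Let g01 : 0 <= g <= 1.
Proof.
have d1 : 1 <= 1 + s * a by rewrite lerDl mulr_ge0.
by rewrite invr_ge0 (le_trans ler01 d1) invf_le1// (lt_le_trans ltr01).
Qed.

Let Mv_le : euclidean_norm (M *m v) <= 1 / t.
Proof. exact: enorm_inv_le. Qed.

Let Su_le : euclidean_norm (Sigma *m u) <= sg / t.
Proof. by apply: le_trans (Sle u) _; rewrite ler_wpM2l// -[t^-1]mul1r. Qed.

Let MSu_le : euclidean_norm (M *m (Sigma *m u)) <= sg / t / t.
Proof. exact: enorm_inv_le. Qed.

Let D_le1 w : `|D w| <= `|al w * be w| + 2 * (sg / t / t).
Proof.
have E : s * h w * (al w * be' w) =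
    dotv v (M *m (Sigma *m u)) - dotv v (Q w *m (Sigma *m u)).
  by rewrite (invmx_update_dotv t0 Bt)// -/M -/(al w) -/(be' w) -/(q w) /h; ring.
have h1 := le_dotv v1 MSu_le.
have h2 := le_dotv v1 (enorm_inv_le t0 (Qt w) Su_le).
have h3 : `|g - h w| <= 1.
  by have := inv1D_dist s0 a0 (q0 w); rewrite le_min => /andP[].
apply: le_trans (ler_normB _ _) _; rewrite lerD//.
  by rewrite normrM ler_piMr.
have /andP[gge0 gle1] := g01.
rewrite E normrM (ger0_norm gge0); rewrite mul1r in h1 h2.
apply: le_trans (ler_piMl (normr_ge0 _) gle1) _.
apply: le_trans (ler_normB _ _) _; lra.
Qed.

(** The parameter [l] balances the two factors of [|al w * be w| * |q w - a|],
    which have different orders of magnitude; it will be [sqrt n]. *)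
Let D_le2 w (l : R) : 0 < l -> `|D w| <=
  s * ((l * (al w * be w) ^+ 2 + (q w - a) ^+ 2 / l) / 2 + `|al w * be' w|).
Proof.
move=> l0; have h3 : `|g - h w| <= s * `|q w - a|.
  by have := inv1D_dist s0 a0 (q0 w); rewrite le_min (distrC a) => /andP[].
have /andP[gge0 gle1] := g01; have /andP[hge0 hle1] := h01 w.
apply: le_trans (ler_normB _ _) _; rewrite [leRHS]mulrDr lerD//.
  rewrite normrM; apply: le_trans (ler_wpM2l (normr_ge0 _) h3) _.
  rewrite mulrCA ler_wpM2l//.
  rewrite -(real_normK (num_real (al w * be w))) -(real_normK (num_real (q w - a))).
  move: `|al w * be w| `|q w - a| => x y.
  have : 0 <= (l * x - y) ^+ 2 / (2 * l).
    by rewrite divr_ge0 ?sqr_ge0// mulr_ge0// ltW.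
  rewrite (_ : (l * x - y) ^+ 2 / (2 * l) =
    (l * x ^+ 2 + y ^+ 2 / l) / 2 - x * y) ?subr_ge0//.
  by field; rewrite gt_eqF.
rewrite normrM (ger0_norm gge0); apply: le_trans (ler_piMl (normr_ge0 _) gle1) _.
rewrite normrM ler_wpM2r// ger0_norm ?mulr_ge0//.
by rewrite ler_piMr.
Qed.

Let int_M b c : integrableR P (fun w => dotv b (xi w) * dotv c (xi w)).
Proof. exact: integrable_linM. Qed.

Let int_D : integrableR P D.
Proof.
apply: le_integrableR (integrableRD (integrableR_norm (int_M (M *m v) u))
  (integrableR_cst P (2 * (sg / t / t)))) D_le1.
exact: measurable_D.
Qed.

Let Ex_residual : \int[P]_w residual (Q w) (xi w) = \int[P]_w D w.
Proof.
under eq_Ex do rewrite residualE.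
have i0 := integrableR_cst P (dotv v (M *m (Sigma *m u))).
have iab := int_M (M *m v) u.
rewrite (ExD (integrableRZ g (integrableRB i0 iab)) int_D).
rewrite (ExZ _ (integrableRB i0 iab)) (ExB i0 iab) Ex_cst.
rewrite (Ex_linM gaussX meanX covX) (dotv_mulmx M v) (trmx_inv_coercive Bt) subrr.
by rewrite mulr0 add0r.
Qed.

Lemma Ex_residual_le_cst :
  `|\int[P]_w residual (invmx (s *: (colv (X w) *m (colv (X w))^T) + B))
      (colv (X w))| <= 3 * sg / t ^+ 2.
Proof.
rewrite Ex_residual.
have iab := integrableR_norm (int_M (M *m v) u).
have i0 := integrableR_cst P (2 * (sg / t / t)).
apply: le_trans (normr_Ex_le int_D (integrableRD iab i0) D_le1) _.
rewrite (ExD iab i0) Ex_cst.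
have hM := Ex_normM_le gaussX meanX covX Sle (M *m v) u.
have := ler_pM (enorm_ge0 _) (enorm_ge0 _) Mv_le ut.
move=> /(ler_wpM2l sg0) /(le_trans hM) {}hM.
apply: le_trans (lerD hM (lexx _)) _.
rewrite le_eqVlt; apply/orP; left; apply/eqP; field.
by rewrite gt_eqF.
Qed.

Lemma Ex_residual_le_var (l : R) : 0 < l ->
  `|\int[P]_w residual (invmx (s *: (colv (X w) *m (colv (X w))^T) + B))
      (colv (X w))| <=
  s * ((l * (3 * sg ^+ 2 / t ^+ 4) +
        (2 * p%:R * sg ^+ 2 / t ^+ 2 + (\tr (Sigma *m invmx B) - a) ^+ 2) / l) / 2
       + sg ^+ 2 / t ^+ 3).
Proof.
move=> l0; rewrite Ex_residual; have [tM _] := psdM.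
have ge0 := @enorm_ge0 R p.
have iab2 : integrableR P (fun w => (al w * be w) ^+ 2).
  apply: eq_integrableR (@integrable_lin4 _ _ _ _ _ _ gaussX meanX
    (M *m v) (M *m v) u u) => w.
  by rewrite /al /be; ring.
have iq : integrableR P (fun w => (q w - a) ^+ 2).
  have i2 := integrable_quad_sqr gaussX meanX tM.
  have i1 := integrableRZ (- (2 * a)) (integrable_quad gaussX meanX tM).
  have i0 := integrableR_cst P (a ^+ 2).
  apply: eq_integrableR (integrableRD (integrableRD i2 i1) i0) => w.
  by rewrite /q; ring.
have iab' := integrableR_norm (int_M (M *m v) (M *m (Sigma *m u))).
have iA := integrableRD (integrableRZ l iab2) (integrableRZ l^-1 iq).
have iB := integrableRD (integrableRZ 2^-1 iA) iab'.
have le2 w : `|D w| <= s * (2^-1 * (l * (al w * be w) ^+ 2 +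
    l^-1 * (q w - a) ^+ 2) + `|al w * be' w|).
  apply: le_trans (D_le2 w l0) _; rewrite le_eqVlt; apply/orP; left; apply/eqP.
  by field; rewrite gt_eqF.
apply: le_trans (normr_Ex_le int_D (integrableRZ s iB) le2) _.
rewrite (ExZ _ iB) ler_wpM2l// (ExD (integrableRZ 2^-1 iA) iab') (ExZ _ iA).
rewrite (ExD (integrableRZ l iab2) (integrableRZ l^-1 iq)) (ExZ _ iab2) (ExZ _ iq).
have e1 : \int[P]_w (al w * be w) ^+ 2 <= 3 * sg ^+ 2 / t ^+ 4.
  have := Ex_sqrM_le gaussX meanX covX Sle (M *m v) u.
  have hn : sg * (euclidean_norm (M *m v) * euclidean_norm u) <= sg * (1 / t * (1 / t)).
    by rewrite ler_wpM2l// ler_pM.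
  have hn0 : 0 <= sg * (euclidean_norm (M *m v) * euclidean_norm u).
    by rewrite !mulr_ge0.
  have := ler_pM hn0 hn0 hn hn; rewrite -!expr2.
  rewrite (_ : (sg * (1 / t * (1 / t))) ^+ 2 = sg ^+ 2 / t ^+ 4).
    by rewrite -mulrA; lra.
  by field; rewrite gt_eqF.
have e2 : \int[P]_w (q w - a) ^+ 2 <=
    2 * p%:R * sg ^+ 2 / t ^+ 2 + (\tr (Sigma *m invmx B) - a) ^+ 2.
  rewrite (Ex_quadB_sqr gaussX meanX covX a tM) lerD2r -!mulrA ler_wpM2l//.
  apply: le_trans (ler_norm _) _; apply: mxtrace_le => y.
  rewrite -!mulmxA; apply: le_trans (Sle _) _.
  have h1 := enorm_inv_le t0 Bt (Sle (M *m y)).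
  have h2 := enorm_inv_coercive t0 Bt y.
  apply: le_trans (ler_wpM2l sg0 h1) _.
  have := ler_wpM2l sg0 (ler_wpM2l sg0 h2) => h3.
  have ti : 0 <= t^-1 by rewrite invr_ge0 ltW.
  rewrite [leLHS]mulrA; apply: le_trans (ler_wpM2r ti h3) _.
  rewrite le_eqVlt; apply/orP; left; apply/eqP; field.
  by rewrite gt_eqF.
have e3 : \int[P]_w `|al w * be' w| <= sg ^+ 2 / t ^+ 3.
  apply: le_trans (Ex_normM_le gaussX meanX covX Sle _ _) _.
  have := ler_wpM2l sg0 (ler_pM (ge0 _) (ge0 _) Mv_le MSu_le) => /le_trans; apply.
  rewrite le_eqVlt; apply/orP; left; apply/eqP; field.
  by rewrite gt_eqF.
have li : 0 <= l^-1 by rewrite invr_ge0 ltW.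
have := ler_wpM2l (ltW l0) e1; have := ler_wpM2l li e2.
rewrite [_ / l]mulrC; lra.
Qed.

End one_vector_step.

(** * Exchanging coordinates of two independent samples *)

Section tuple_law.
Context d (T : measurableType d) (R : realType) (m : nat).

Definition box (B : 'I_m -> set T) : set (m.-tuple T) :=
  \bigcap_(i in [set: 'I_m]) (fun u : m.-tuple T => tnth u i) @^-1` B i.

Lemma measurable_box B : (forall i, measurable (B i)) -> measurable (box B).
Proof.
move=> mB; apply: fin_bigcap_measurable => [|i _]; first exact: finite_finset.
by rewrite -[X in measurable X]setTI; exact: measurable_tnth.
Qed.

(** Boxes form a pi-system that generates the sigma-algebra of tuples. *)
Lemma tuple_measure_unique (m1 m2 : {measure set (m.-tuple T) -> \bar R}) :
  (m1 setT < +oo)%E ->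
  (forall B, (forall i, measurable (B i)) -> m1 (box B) = m2 (box B)) ->
  forall A, measurable A -> m1 A = m2 A.
Proof.
move=> m1oo m12.
pose G := [set A | exists2 B : 'I_m -> set T, forall i, measurable (B i) & A = box B].
have GT : G setT.
  exists (fun=> setT) => [i|]; first exact: measurableT.
  by apply/seteqP; split.
move=> A mA; apply: (measure_unique G (fun=> setT)) => //.
- apply/seteqP; split.
    apply: smallest_sub; first exact: smallest_sigma_algebra.
    move=> C; rewrite -bigcup_seq => -[i _ [B mB <-]].
    apply: sub_sigma_algebra; exists (fun j => if j == i then B else setT).
      by move=> j; case: ifP => _.
    apply/seteqP; split=> u.
      by move=> [_ Bu] j _ /=; case: eqP => [->|].
    by move=> /(_ i Logic.I) /=; rewrite eqxx => Bu; split.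
  apply: smallest_sub; first exact: sigma_algebra_measurable.
  by move=> _ [B mB ->]; exact: measurable_box.
- move=> _ _ [B mB ->] [C mC ->]; exists (fun i => B i `&` C i).
    by move=> i; exact: measurableI.
  by rewrite /box -bigcapI.
- by apply/seteqP; split=> // x _; exists 0%N.
- by move=> _ [B mB ->]; exact: m12.
Qed.

End tuple_law.

Section pair_probability.
Context d (T : measurableType d) (R : realType) (P : probability T R).

Let prod : {measure set (T * T) -> \bar R} := (P \x P)%E.

Let prod_setT : prod setT = 1%E.
Proof.
rewrite -setXTT [LHS]product_measure1E//.
by rewrite [X in (X * X)%E](@probability_setT _ _ _ P : _ = 1%E) mule1.
Qed.

HB.instance Definition _ := Measure.on prod.
HB.instance Definition _ := @Measure_isProbability.Build _ _ _ prod prod_setT.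

Definition pair_probability : probability (T * T)%type R := prod.

End pair_probability.

Section pair_expectation.
Context d (T : measurableType d) (R : realType) (P : probability T R).
Local Notation PP := (pair_probability P).

Lemma pair_probability_box (A B : set T) : measurable A -> measurable B ->
  PP (A `*` B) = (P A * P B)%E.
Proof. exact: (@product_measure1E _ _ _ _ _ P P). Qed.

Lemma Ex_pair (F : T * T -> R) : integrableR PP F ->
  (forall w, integrableR P (fun w' => F (w, w'))) ->
  integrableR P (fun w => \int[P]_w' F (w, w')) /\
  \int[PP]_z F z = \int[P]_w \int[P]_w' F (w, w').
Proof.
move=> iF iFw.
have E : EFin \o (fun w => \int[P]_w' F (w, w')) = fubini_F P (EFin \o F).
  by apply/funext => w; rewrite /fubini_F/= integral_EFin_Ex.
split; first by rewrite /integrableR E; exact: integrable_fubini_F.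
rewrite /Rintegral; congr fine.
transitivity (\int[P]_w fubini_F P (EFin \o F) w)%E.
  by rewrite integral12_prod_meas1.
by rewrite -E.
Qed.

Lemma Ex_fst (f : T -> R) : integrableR P f ->
  integrableR PP (fun z => f z.1) /\ \int[PP]_z f z.1 = \int[P]_w f w.
Proof.
move=> fi; have mf := measurable_integrableR fi.
have i1 : integrableR PP (fun z => f z.1).
  apply/(@integrable12ltyP _ _ _ _ _ P P).
    by apply/measurable_EFinP; exact: measurableT_comp.
  rewrite /=; have /integrableP[_ fy] := fi.
  under eq_integral => w _.
    rewrite integral_cst// [X in (_ * X)%E](@probability_setT _ _ _ P : _ = 1%E).
    rewrite mule1; over.
  by [].
split=> //; have [_ ->] := Ex_pair i1 (fun w => integrableR_cst P (f w)).
by apply: eq_Ex => w; exact: (Ex_cst P (f w)).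
Qed.

End pair_expectation.

Section swap.
Context d (T : measurableType d) (R : realType) (P : probability T R)
  d' (T' : measurableType d') (n : nat) (X : 'I_n -> {RV P >-> T'}).
Hypothesis indepX : mutually_independent X.
Local Notation PP := (pair_probability P).
Local Notation config := ('I_n -> T').

(** Functions ['I_n -> T'] carry no sigma-algebra, so a pair of samples is encoded
    as a tuple of length [n + n]. *)
Definition measurable_config2 (Phi : config -> config -> R) :=
  measurable_fun setT (fun u : (n + n).-tuple T' =>
    Phi (fun i => tnth u (lshift n i)) (fun i => tnth u (rshift n i))).

Let sel (b : bool) (z : T * T) := if b then z.2 else z.1.

(** The two samples [X z.1] and [X z.2], one after the other, after exchange of
    the coordinates selected by [b]. *)
Let stack (b : 'I_n -> bool) (z : T * T) : (n + n).-tuple T' :=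
  [tuple match fintype.split j with
   | inl i => X i (sel (b i) z) | inr i => X i (sel (~~ b i) z) end | j < n + n].

Let tnth_stackl b z i : tnth (stack b z) (lshift n i) = X i (sel (b i) z).
Proof. by rewrite tnth_mktuple (unsplitK (inl i) : fintype.split (lshift n i) = _). Qed.

Let tnth_stackr b z i : tnth (stack b z) (rshift n i) = X i (sel (~~ b i) z).
Proof. by rewrite tnth_mktuple (unsplitK (inr i) : fintype.split (rshift n i) = _). Qed.

Let measurable_stack b : measurable_fun setT (stack b).
Proof.
apply/measurable_fun_tnthP => j.
have msel i c : measurable_fun setT (fun z => X i (sel c z)).
  case: c; first exact: (measurableT_comp (measurable_funPT (X i)) measurable_snd).
  exact: (measurableT_comp (measurable_funPT (X i)) measurable_fst).
rewrite (_ : _ \o _ = fun z => match fintype.split j with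
   | inl i => X i (sel (b i) z) | inr i => X i (sel (~~ b i) z) end).
  by case: (fintype.split j) => i.
by apply/funext => z; rewrite /= tnth_mktuple.
Qed.

Let prob_config (B : 'I_n -> set T') : (forall i, measurable (B i)) ->
  P [set w | forall i, B i (X i w)] = (\prod_(i < n) P (X i @^-1` B i))%E.
Proof.
move=> mB; have := indepX [set: 'I_n]%SET mB.
rewrite (_ : \bigcap_(j in _) _ = [set w | forall i, B i (X i w)]); last first.
  apply/seteqP; split=> w h; last by move=> i _; exact: h.
  by move=> i; apply: h; rewrite /= inE.
by move=> ->; apply: eq_bigl => i; rewrite inE.
Qed.

(** Independent copies of the same variable may be exchanged: the right-hand side
    does not depend on [b]. *)
Let stack_box b (B : 'I_(n + n) -> set T') : (forall i, measurable (B i)) ->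
  PP (stack b @^-1` box B) =
  (\prod_(i < n) (P (X i @^-1` B (lshift n i)) * P (X i @^-1` B (rshift n i))))%E.
Proof.
move=> mB.
pose B1 i := if b i then B (rshift n i) else B (lshift n i).
pose B2 i := if b i then B (lshift n i) else B (rshift n i).
have mB1 i : measurable (B1 i) by rewrite /B1; case: ifP.
have mB2 i : measurable (B2 i) by rewrite /B2; case: ifP.
have mC (C : 'I_n -> set T') : (forall i, measurable (C i)) ->
    measurable [set w | forall i, C i (X i w)].
  move=> mC; rewrite (_ : [set w | _] = \bigcap_(i in [set: 'I_n]) (X i @^-1` C i)).
    apply: fin_bigcap_measurable => [|i _]; first exact: finite_finset.
    by rewrite -[X in measurable X]setTI; exact: (measurable_funPT (X i)).
  by apply/seteqP; split=> w h; [move=> i _; exact: h|move=> i; exact: h].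
rewrite (_ : _ @^-1` _ = [set w | forall i, B1 i (X i w)] `*`
    [set w | forall i, B2 i (X i w)]).
  rewrite pair_probability_box; [|exact: mC..].
  rewrite !prob_config// -big_split; apply: eq_bigr => i _ /=.
  by rewrite /B1 /B2; case: (b i); rewrite // muleC.
apply/seteqP; split=> [z h|z [h1 h2] j _].
  split=> i; rewrite /B1 /B2.
    have := h (lshift n i) Logic.I; have := h (rshift n i) Logic.I.
    by rewrite /= tnth_stackl tnth_stackr /sel; case: (b i).
  have := h (lshift n i) Logic.I; have := h (rshift n i) Logic.I.
  by rewrite /= tnth_stackl tnth_stackr /sel; case: (b i).
rewrite /=; case: (split_ordP j) => i ->.
  rewrite tnth_stackl; have := h1 i; have := h2 i; rewrite /B1 /B2 /sel.
  by case: (b i).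
rewrite tnth_stackr; have := h1 i; have := h2 i; rewrite /B1 /B2 /sel.
by case: (b i).
Qed.

(** The laws of the two arrangements agree on boxes, by [stack_box], hence
    everywhere. *)
Lemma Ex_exchange (b b' : 'I_n -> bool) (Phi : config -> config -> R) :
  let F c z := Phi (fun i => X i (if c i then z.2 else z.1))
                   (fun i => X i (if c i then z.1 else z.2)) in
  measurable_config2 Phi -> integrableR PP (F b) ->
  integrableR PP (F b') /\ \int[PP]_z F b' z = \int[PP]_z F b z.
Proof.
move=> F mPhi.
pose h (u : (n + n).-tuple T') :=
  Phi (fun i => tnth u (lshift n i)) (fun i => tnth u (rshift n i)).
have FE c : F c = h \o stack c.
  apply/funext => z; rewrite /F /h /=; congr (Phi _ _); apply/funext => i.
    by rewrite tnth_stackl.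
  by rewrite tnth_stackr /sel; case: (c i).
have mh : measurable_fun setT (EFin \o h) by exact/measurable_EFinP.
pose S c : {mfun (T * T)%type >-> (n + n).-tuple T'} :=
  mfun_Sub (mem_set (measurable_stack c)).
have transfer (g : (n + n).-tuple T' -> \bar R) (c : 'I_n -> bool) :
    measurable_fun setT g -> (forall u, 0 <= g u)%E ->
    (\int[PP]_z g (stack c z) = \int[pushforward PP (S b)]_u g u)%E.
  move=> mg g0; transitivity (\int[pushforward PP (S c)]_u g u)%E.
    by rewrite ge0_integral_pushforward.
  apply: eq_measure_integral => A mA _; apply: tuple_measure_unique => //.
    apply: le_lt_trans (probability_le1 PP _) _ => //.
      exact: measurableT.
    exact: ltry.
  by move=> B mB; exact: etrans (stack_box c mB) (esym (stack_box b mB)).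
rewrite !FE => iF.
have mF c : measurable_fun setT (h \o stack c) by exact: measurableT_comp.
have iF' : integrableR PP (h \o stack b').
  apply/integrableP; split; first by apply/measurable_EFinP; exact: mF.
  have mah : measurable_fun setT (abse \o (EFin \o h)) by exact: measurableT_comp.
  have a0 u : (0 <= (abse \o (EFin \o h)) u)%E by exact: abse_ge0.
  apply: le_lt_trans (proj2 (integrableP _ _ _ iF)).
  have e := etrans (transfer _ b' mah a0) (esym (transfer _ b mah a0)).
  by rewrite le_eqVlt; apply/orP; left; apply/eqP; exact: e.
split=> //; rewrite /Rintegral; congr fine.
rewrite [LHS]integralE [RHS]integralE; congr (_ - _)%E.
  have mp := measurable_funepos mh; have p0 := funepos_ge0 (EFin \o h).
  have e := etrans (transfer _ b' mp p0) (esym (transfer _ b mp p0)).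
  by move: e; rewrite unlock; exact.
have mp := measurable_funeneg mh; have p0 := funeneg_ge0 (EFin \o h).
have e := etrans (transfer _ b' mp p0) (esym (transfer _ b mp p0)).
by move: e; rewrite unlock; exact.
Qed.

End swap.

(** * Replacing one vector, and the Efron-Stein inequality *)

Section configurations.
Context d (T : measurableType d) (R : realType) (P : probability T R)
  d' (T' : measurableType d') (n : nat) (X : 'I_n -> {RV P >-> T'}).
Hypothesis indepX : mutually_independent X.
Local Notation PP := (pair_probability P).
Local Notation config := ('I_n -> T').

Definition measurable_config (f : config -> R) :=
  measurable_fun setT (fun u : n.-tuple T' => f (tnth u)).

Lemma measurable_config_comp f d0 (T0 : measurableType d0)
    (Y : 'I_n -> T0 -> T') : measurable_config f ->
  (forall i, measurable_fun setT (Y i)) ->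
  measurable_fun setT (fun z => f (fun i => Y i z)).
Proof.
move=> mf mY.
rewrite (_ : (fun z => _) = (fun u : n.-tuple T' => f (tnth u)) \o
    (fun z => [tuple Y i z | i < n])).
  apply: measurableT_comp => //; apply/measurable_fun_tnthP => i.
  rewrite (_ : _ \o _ = Y i)//.
  by apply/funext => z; rewrite /= tnth_mktuple.
apply/funext => z /=; congr f; apply/funext => i.
by rewrite tnth_mktuple.
Qed.

Definition update (k : 'I_n) (c : config) (e : T') : config :=
  fun i => if i == k then e else c i.

Let XT i : measurable_fun setT (X i). Proof. exact: measurable_funPT. Qed.

Let X1 i : measurable_fun setT (fun z : T * T => X i z.1).
Proof. exact: (measurableT_comp (XT i) measurable_fst). Qed.

Let X2 i : measurable_fun setT (fun z : T * T => X i z.2).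
Proof. exact: (measurableT_comp (XT i) measurable_snd). Qed.

(** One vector of the sample may be resampled independently of the others. *)
Lemma Ex_replace (f : config -> R) (k : 'I_n) :
  measurable_config f -> integrableR P (fun w => f (fun i => X i w)) ->
  integrableR PP (fun z => f (update k (fun i => X i z.1) (X k z.2))) /\
  \int[PP]_z f (update k (fun i => X i z.1) (X k z.2)) =
  \int[P]_w f (fun i => X i w).
Proof.
move=> mf fi.
have [i1 e1] := Ex_fst fi.
have mf2 : @measurable_config2 R _ T' n (fun c c' => f c).
  by apply: (measurable_config_comp mf) => i; exact: measurable_tnth.
have [i2 e2] := Ex_exchange indepX (b := xpred0) (pred1 k) mf2 i1.
have E z : f (fun i => X i (if pred1 k i then z.2 else z.1)) =
    f (update k (fun i => X i z.1) (X k z.2)).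
  congr f; apply/funext => i; rewrite /update /=.
  by case: eqP => [->|].
split; first by apply: eq_integrableR i2 => z; exact: E.
by rewrite -e1 -e2; apply: eq_Ex => z; rewrite E.
Qed.

Section efron_stein.
Variables (f : config -> R) (K b : R).
Hypotheses (mf : measurable_config f) (fK : forall c, `|f c| <= K).
Hypothesis fb : forall k c e, `|f c - f (update k c e)| <= b.

(** Interpolates between the two samples, from [c] for [k = 0] to [c'] for
    [k = n]. *)
Let Z (k : nat) (c c' : config) : config := fun i => if (i < k)%N then c' i else c i.

Let mZ2 d0 (T0 : measurableType d0) (Y Y' : 'I_n -> T0 -> T') k :
  (forall i, measurable_fun setT (Y i)) -> (forall i, measurable_fun setT (Y' i)) ->
  measurable_fun setT (fun z => f (Z k (fun i => Y i z) (fun i => Y' i z))).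
Proof.
move=> mY mY'; rewrite /Z.
apply: (measurable_config_comp (Y := fun i z => if (i < k)%N then Y' i z else Y i z) mf).
by move=> i; case: (i < k)%N.
Qed.

Let fX w := f (fun i => X i w).
Let m := \int[P]_w fX w.

Let int_f : integrableR P fX.
Proof.
apply: (@integrableR_bounded _ _ _ _ _ K); first exact: (measurable_config_comp mf XT).
by move=> w; exact: fK.
Qed.

Let int_f2 : integrableR P (fun w => fX w ^+ 2).
Proof.
apply: (@integrableR_bounded _ _ _ _ _ (K ^+ 2)).
  by apply: measurable_funX; exact: (measurable_config_comp mf XT).
move=> w; rewrite normrX ler_pXn2r// ?nnegrE//; first exact: fK.
exact: le_trans (normr_ge0 _) (fK (fun i => X i w)).
Qed.

Let Phi k (c c' : config) := f c * (f (Z k c c') - f (Z k.+1 c c')).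
Let c1 (z : T * T) : config := fun i => X i z.1.
Let c2 (z : T * T) : config := fun i => X i z.2.

Let b0 (k : 'I_n) : 0 <= b.
Proof. exact: le_trans (normr_ge0 _) (fb k (fun i => X i point) (X k point)). Qed.

Let fZb (k : 'I_n) c c' : `|f (Z k c c') - f (Z k.+1 c c')| <= b.
Proof.
rewrite (_ : Z k.+1 c c' = update k (Z k c c') (c' k))//.
apply/funext => i; rewrite /Z /update ltnS leq_eqVlt.
case: (eqVneq i k) => [->|ik]; first by rewrite eqxx.
by rewrite (_ : (i == k :> nat) = false)//; exact: negbTE.
Qed.

Let int_Phi (k : 'I_n) : integrableR PP (fun z => Phi k (c1 z) (c2 z)).
Proof.
apply: (@integrableR_bounded _ _ _ _ _ (K * b)).
  apply: measurable_funM; first exact: (measurable_config_comp mf X1).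
  by apply: measurable_funB; exact: mZ2.
by move=> z; rewrite normrM ler_pM.
Qed.

(** Exchanging the coordinate [k] of the two samples exchanges [Z k] and
    [Z k.+1]. Averaging [Phi k] with its image under the exchange therefore
    produces a product of two differences, each at most [b]. *)
Let Ex_Phi (k : 'I_n) : \int[PP]_z Phi k (c1 z) (c2 z) <= b ^+ 2 / 2.
Proof.
have mPhi : measurable_config2 (Phi k).
  apply: measurable_funM.
    by apply: (measurable_config_comp mf) => i; exact: measurable_tnth.
  by apply: measurable_funB; apply: mZ2 => i; exact: measurable_tnth.
have [i2 e2] := Ex_exchange indepX (b := xpred0) (pred1 k) mPhi (int_Phi k).
have ltk i : i != k -> (i < k.+1)%N = (i < k)%N.
  move=> ik; rewrite ltnS [LHS]leq_eqVlt (_ : (i == k :> nat) = false)//.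
  exact: negbTE.
have E z : Phi k (fun i => X i (if pred1 k i then z.2 else z.1))
    (fun i => X i (if pred1 k i then z.1 else z.2)) =
    - (f (update k (c1 z) (X k z.2)) *
       (f (Z k (c1 z) (c2 z)) - f (Z k.+1 (c1 z) (c2 z)))).
  rewrite /Phi -mulrN opprB.
  congr (f _ * (f _ - f _)); apply/funext => i; rewrite /update /Z /c1 /c2 /=.
  - by case: eqP => [->|].
  - case: (eqVneq i k) => [->|ik]; first by rewrite ltnn ltnSn.
    by rewrite (ltk _ ik); case: ltnP.
  - case: (eqVneq i k) => [->|ik]; first by rewrite ltnn ltnSn.
    by rewrite (ltk _ ik); case: ltnP.
have {}e2 : \int[PP]_z - (f (update k (c1 z) (X k z.2)) *
    (f (Z k (c1 z) (c2 z)) - f (Z k.+1 (c1 z) (c2 z)))) =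
    \int[PP]_z Phi k (c1 z) (c2 z).
  by rewrite -[RHS]e2; apply: eq_Ex => z; rewrite E.
have {}i2 := eq_integrableR E i2.
rewrite ler_pdivlMr// mulr_natr mulr2n -[X in X + _]e2 -(ExD i2 (int_Phi k)).
rewrite -(Ex_cst PP (b ^+ 2)); apply: le_Ex; first exact: integrableRD.
  exact: integrableR_cst.
move=> z; rewrite addrC /Phi -mulrBl.
apply: le_trans (ler_norm _) _; rewrite normrM expr2 ler_pM//.
Qed.

(** With [c] and [c'] independent samples, the variance is
    [E (f c * (f c - f c'))]; the second factor telescopes along the
    interpolation [Z], and [Ex_Phi] bounds each term. *)
Lemma efron_stein :
  \int[P]_w (f (fun i => X i w) - \int[P]_w' f (fun i => X i w')) ^+ 2 <=
  n%:R * (b ^+ 2 / 2).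
Proof.
change (\int[P]_w (fX w - m) ^+ 2 <= n%:R * (b ^+ 2 / 2)).
have [i11 e11] := Ex_fst int_f2.
have i12 : integrableR PP (fun z => fX z.1 * fX z.2).
  apply: (@integrableR_bounded _ _ _ _ _ (K * K)).
    apply: measurable_funM; first exact: (measurable_config_comp mf X1).
    exact: (measurable_config_comp mf X2).
  by move=> z; rewrite normrM ler_pM//; exact: fK.
have e12 : \int[PP]_z (fX z.1 * fX z.2) = m ^+ 2.
  have [_ ->] := Ex_pair i12 (fun w => integrableRZ (fX w) int_f).
  rewrite -/m expr2 -[RHS](ExZ m int_f); apply: eq_Ex => w.
  by rewrite [RHS]mulrC; exact: (ExZ (fX w) int_f).
have -> : \int[P]_w (fX w - m) ^+ 2 = \int[PP]_z (fX z.1 ^+ 2 - fX z.1 * fX z.2).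
  rewrite (ExB i11 i12) e11 e12.
  have im := integrableRZ (- (2 * m)) int_f.
  have ic := integrableR_cst P (m ^+ 2).
  under eq_Ex => w.
    rewrite (_ : _ ^+ 2 = fX w ^+ 2 + - (2 * m) * fX w + m ^+ 2); last by ring.
    over.
  rewrite (ExD (integrableRD int_f2 im) ic) (ExD int_f2 im) Ex_cst (ExZ _ int_f) -/m.
  by ring.
have tele z : fX z.1 ^+ 2 - fX z.1 * fX z.2 =
    \sum_(k <- index_enum 'I_n) Phi k (c1 z) (c2 z).
  rewrite -mulr_sumr expr2 -mulrBr; congr (_ * _).
  have -> : fX z.1 = f (Z 0 (c1 z) (c2 z)) by congr f; apply/funext.
  have -> : fX z.2 = f (Z n (c1 z) (c2 z)).
    by congr f; apply/funext => i; rewrite /Z ltn_ord.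
  have := @telescope_sumr _ 0 n (fun k => f (Z k (c1 z) (c2 z))) (leq0n n).
  rewrite big_mkord => e; rewrite -[LHS]opprB -e -sumrN.
  by apply: eq_bigr => k _; rewrite opprB.
under eq_Ex do rewrite tele.
rewrite (Ex_sum _ (fun k => int_Phi k)).
rewrite [leRHS](_ : _ = \sum_(k < n) b ^+ 2 / 2); last first.
  by rewrite sumr_const card_ord mulr_natl.
by apply: ler_sum => k _; exact: Ex_Phi.
Qed.

End efron_stein.
End configurations.

(** * The estimate at a fixed sample size *)

Section fixed_sample_size.
Context d (T : measurableType d) (R : realType) (P : probability T R)
  (n p : nat) (X : 'I_n -> {RV P >-> p.-tuple R}) (Sigma A : 'M[R]_p)
  (s : 'I_n -> R) (v : 'cV[R]_p) (t sg C : R).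
Hypotheses (n0 : (0 < n)%N) (indepX : mutually_independent X)
  (gaussX : forall j, gaussian_vector (X j)) (meanX : forall j, centered (X j))
  (covX : forall j, has_covariance (X j) Sigma).
Hypotheses (s0 : forall j, 0 <= s j) (t0 : 0 < t) (At : coercive t A)
  (v1 : euclidean_norm v = 1) (sg0 : 0 <= sg)
  (Sle : forall x, euclidean_norm (Sigma *m x) <= sg * euclidean_norm x)
  (pC : p%:R <= C * n%:R).
Local Notation config := ('I_n -> p.-tuple R).
Local Notation Xc w := (fun i => X i w).

Let outer (x : p.-tuple R) : 'M[R]_p := colv x *m (colv x)^T.

Definition regularized (c : config) : 'M[R]_p :=
  \sum_j s j *: (colv (c j) *m (colv (c j))^T) + A.

(** The regularized sample covariance with the vector [k] left out. *)
Let loo (k : 'I_n) (c : config) : 'M[R]_p :=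
  \sum_(j | j != k) s j *: outer (c j) + A.

Let Q c := invmx (regularized c).
Let tau c := \tr (Sigma *m Q c).
Let taub := \int[P]_w tau (Xc w).
Let gb := \sum_j s j * (1 + s j * taub)^-1.
Let u := invmx (gb *: Sigma + A) *m v.
Let lam : R := Num.sqrt n%:R.
Let k0 : 'I_n := Ordinal n0.

Let psdS : psdmx Sigma.
Proof. exact: (psdmx_cov (gaussX k0) (meanX k0) (covX k0)). Qed.

Let regularizedE k c : regularized c = s k *: outer (c k) + loo k c.
Proof. by rewrite /regularized (bigD1 k)//= addrA. Qed.

Let loo_update k c x : loo k (update k c x) = loo k c.
Proof.
congr (_ + _); apply: eq_bigr => j jk.
by rewrite /update (negbTE jk).
Qed.

Let regularized_update k c x :
  regularized (update k c x) = s k *: outer x + loo k c.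
Proof. by rewrite (regularizedE k) loo_update /update eqxx. Qed.

Let loo_coercive k c : coercive t (loo k c).
Proof.
apply: coerciveD => //; apply: psdmx_sum => j _.
by apply: psdmxZ => //; exact: psdmx_outer.
Qed.

Lemma regularized_coercive c : coercive t (regularized c).
Proof.
apply: coerciveD => //; apply: psdmx_sum => j _.
by apply: psdmxZ => //; exact: psdmx_outer.
Qed.

Let ti0 : 0 <= t^-1. Proof. by rewrite invr_ge0 ltW. Qed.

Let tau_ge0 c : 0 <= tau c.
Proof.
apply: (mxtrace_cov_psd_ge0 (gaussX k0) (meanX k0) (covX k0)).
exact: (psdmx_inv_coercive t0 (regularized_coercive c)).
Qed.

Let tau_le c : `|tau c| <= p%:R * (sg / t).
Proof.
apply: mxtrace_le => x; rewrite -mulmxA.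
apply: le_trans (Sle _) _; rewrite -mulrA ler_wpM2l// mulrC.
exact: (enorm_inv_coercive t0 (regularized_coercive c)).
Qed.

Let tau_loo k c : `|tau c - \tr (Sigma *m invmx (loo k c))| <= sg / t.
Proof.
rewrite /tau /Q (regularizedE k).
exact: (mxtrace_invmx_update_dist t0 (loo_coercive k c)).
Qed.

Let tau_update k c x : `|tau c - tau (update k c x)| <= 2 * (sg / t).
Proof.
have h1 := tau_loo k c; have h2 := tau_loo k (update k c x).
rewrite loo_update in h2; rewrite distrC in h2.
rewrite mulrDl mul1r; apply: le_trans (ler_distD _ _ _) _.
exact: lerD h1 h2.
Qed.

Let measurable_colv_tnth d0 (T0 : measurableType d0) (Y : T0 -> p.-tuple R) :
  measurable_fun setT Y -> measurable_mx (fun z => colv (Y z)).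
Proof.
move=> mY i j; under eq_fun do rewrite mxE.
exact: (measurableT_comp (measurable_tnth i) mY).
Qed.

Let measurable_colv j :
  measurable_mx (fun c : n.-tuple (p.-tuple R) => colv (tnth c j)).
Proof. by apply: measurable_colv_tnth; exact: measurable_tnth. Qed.

Let measurable_Q : measurable_mx (fun c : n.-tuple (p.-tuple R) => Q (tnth c)).
Proof.
apply: measurable_invmx => [|c]; last first.
  exact: (coercive_unit t0 (regularized_coercive _)).
apply: measurable_mxD; last exact: measurable_mx_cst.
apply: measurable_mx_sum => j; apply: measurable_mxZ; first exact: measurable_cst.
by apply: measurable_mxM; [|apply: measurable_mx_tr]; exact: measurable_colv.
Qed.

Let measurable_tau : measurable_config tau.
Proof.
apply: measurable_mxtrace; apply: measurable_mxM => //.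
Qed.

Let mX j : measurable_fun setT (X j). Proof. exact: measurable_funPT. Qed.

Let int_tau : integrableR P (fun w => tau (Xc w)).
Proof.
apply: (@integrableR_bounded _ _ _ _ _ (p%:R * (sg / t))) => //.
exact: (measurable_config_comp measurable_tau mX).
Qed.

Let taub_ge0 : 0 <= taub. Proof. exact: Ex_ge0. Qed.

Let int_tau_dev : integrableR P (fun w => (tau (Xc w) - taub) ^+ 2).
Proof.
apply: (@integrableR_bounded _ _ _ _ _ ((p%:R * (sg / t) + taub) ^+ 2)).
  apply: measurable_funX; apply: measurable_funB; last exact: measurable_cst.
  exact: (measurable_config_comp measurable_tau mX).
move=> w; rewrite normrX ler_pXn2r ?nnegrE//.
- apply: le_trans (ler_normB _ _) _; rewrite (ger0_norm taub_ge0) lerD2r.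
  exact: tau_le.
- by rewrite addr_ge0// mulr_ge0// divr_ge0// ltW.
Qed.

(** Efron-Stein with increments at most [2 sigma / t]. *)
Let variance_tau :
  \int[P]_w (tau (Xc w) - taub) ^+ 2 <= 2 * n%:R * sg ^+ 2 / t ^+ 2.
Proof.
have := efron_stein indepX measurable_tau tau_le tau_update.
move=> /le_trans; apply; rewrite le_eqVlt; apply/orP; left; apply/eqP.
by field; rewrite gt_eqF.
Qed.

Let n0R : 0 < n%:R :> R. Proof. by rewrite ltr0n. Qed.
Let lam0 : 0 < lam. Proof. by rewrite sqrtr_gt0. Qed.
Let lam_sqr : lam ^+ 2 = n%:R. Proof. by rewrite sqr_sqrtr// ltW. Qed.
Let n1R : 1 <= n%:R :> R. Proof. by rewrite ler1n. Qed.
Let lam1 : 1 <= lam. Proof. by rewrite -[1]sqrtr1 ler_wsqrtr. Qed.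

Let gbS_coercive (g : R) : 0 <= g -> coercive t (g *: Sigma + A).
Proof. by move=> g0; apply: coerciveD => //; exact: psdmxZ. Qed.

Let gb0 : 0 <= gb.
Proof.
by apply: sumr_ge0 => j _; rewrite mulr_ge0// invr_ge0 addr_ge0// mulr_ge0.
Qed.

Let u_le : euclidean_norm u <= 1 / t.
Proof. by rewrite -v1; exact: (enorm_inv_coercive t0 (gbS_coercive gb0)). Qed.

Let residual j c := resolvent_residual Sigma (s j) taub v u (Q c) (colv (c j)).

Let v_le : euclidean_norm v <= 1. Proof. by rewrite v1. Qed.

(** The identity [Q - G = Q (G^-1 - Q^-1) G] for the two inverses, applied to
    [v]. *)
Let resolvent_expansion c :
  dotv v (Q c *m v) - dotv v u = \sum_j s j * residual j c.
Proof.
have BU := coercive_unit t0 (regularized_coercive c).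
have GU := coercive_unit t0 (gbS_coercive gb0).
have uE : (gb *: Sigma + A) *m u = v by rewrite mulmxA mulmxV// mul1mx.
have -> : dotv v u = dotv v (Q c *m (regularized c *m u)).
  by rewrite (mulmxA (Q c)) mulVmx// mul1mx.
rewrite -dotvBr -mulmxBr -{2}uE -mulmxBl /regularized opprD addrACA subrr addr0.
rewrite mulmxBl mulmxBr dotvBr -scalemxAl -scalemxAr dotvZr /gb mulr_suml.
rewrite mulmx_suml mulmx_sumr dotv_sumr -sumrB; apply: eq_bigr => j _.
rewrite /residual /resolvent_residual mulrBr mulrA; congr (_ - _).
by rewrite -scalemxAl outer_mulmx -!scalemxAr !dotvZr; ring.
Qed.

Let measurable_residual j : measurable_config (residual j).
Proof.
apply: measurable_funB.
  apply: measurable_funM; first exact: measurable_cst.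
  apply: measurable_dotv; first exact: measurable_mx_cst.
  by apply: measurable_mxM => //; exact: measurable_mx_cst.
apply: measurable_funM; apply: measurable_dotv.
- exact: measurable_mx_cst.
- by apply: measurable_mxM => //; exact: measurable_colv.
- exact: measurable_colv.
- exact: measurable_mx_cst.
Qed.

Let residual_le j c : `|residual j c| <=
  sg / t / t + t^-1 ^+ 2 * dotv (colv (c j)) (colv (c j)).
Proof.
have gle : 0 <= (1 + s j * taub)^-1 <= 1.
  have d1 : 1 <= 1 + s j * taub by rewrite lerDl mulr_ge0.
  by rewrite invr_ge0 (le_trans ler01 d1) invf_le1// (lt_le_trans ltr01).
have /andP[g0 g1] := gle; have cB := regularized_coercive c.
have Su : euclidean_norm (Sigma *m u) <= sg / t.
  by apply: le_trans (Sle u) _; rewrite ler_wpM2l// -[t^-1]mul1r.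
apply: le_trans (ler_normB _ _) _; apply: lerD.
  rewrite normrM (ger0_norm g0); apply: le_trans (ler_piMl (normr_ge0 _) g1) _.
  by have := le_dotv v_le (enorm_inv_le t0 cB Su); rewrite mul1r.
rewrite normrM -sqr_enorm -exprMn.
set x := colv (c j).
have h1 := le_dotv v_le (enorm_inv_coercive t0 cB x).
have h2 := le_dotv (lexx (euclidean_norm x)) u_le.
rewrite mul1r in h1; rewrite mul1r in h2.
by rewrite expr2 [in leRHS](mulrC t^-1) ler_pM.
Qed.

Let int_sqr_norm j : integrableR P (fun w => dotv (colv (X j w)) (colv (X j w))).
Proof.
apply: eq_integrableR (integrable_quad (gaussX j) (meanX j) (trmx1 _ _)) => w.
by rewrite mul1mx.
Qed.

Let int_residual j : integrableR P (fun w => residual j (Xc w)).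
Proof.
apply: le_integrableR (integrableRD (integrableR_cst P (sg / t / t))
  (integrableRZ (t^-1 ^+ 2) (int_sqr_norm j))) _.
  exact: (measurable_config_comp (@measurable_residual j) mX).
by move=> w; exact: residual_le.
Qed.

Let int_residual_update j w : integrableR P
  (fun w' => residual j (update j (Xc w) (X j w'))).
Proof.
apply: le_integrableR (integrableRD (integrableR_cst P (sg / t / t))
  (integrableRZ (t^-1 ^+ 2) (int_sqr_norm j))) _.
  apply: (measurable_config_comp
    (Y := fun i w' => if i == j then X j w' else X i w) (@measurable_residual j)).
  by move=> i; case: (i == j) => //; exact: measurable_cst.
move=> w'; apply: le_trans (residual_le j _) _.
by rewrite /update eqxx.
Qed.

(** The expectation over the vector [j] alone, the others being held fixed, so
    that the bounds for one vector and a deterministic matrix apply. *)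
Let Ex_residual_fubini j : exists I : T -> R,
  [/\ integrableR P I, \int[P]_w residual j (Xc w) = \int[P]_w I w &
   forall w, I w = \int[P]_w' resolvent_residual Sigma (s j) taub v u
     (invmx (s j *: (colv (X j w') *m (colv (X j w'))^T) + loo j (Xc w)))
     (colv (X j w'))].
Proof.
have [i1 e1] := Ex_replace indepX j (@measurable_residual j) (int_residual j).
have [i2 e2] := Ex_pair i1 (int_residual_update j).
exists (fun w => \int[P]_w' residual j (update j (Xc w) (X j w'))).
split; [exact: i2|by rewrite -e1 e2|].
move=> w; apply: eq_Ex => w'.
by rewrite /residual /Q regularized_update /update eqxx.
Qed.

Let Ex_residual_cst j : `|\int[P]_w residual j (Xc w)| <= 3 * sg / t ^+ 2.
Proof.
have [I [iI -> IE]] := Ex_residual_fubini j.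
rewrite -(Ex_cst P (3 * sg / t ^+ 2)).
apply: normr_Ex_le => //; first exact: integrableR_cst.
move=> w; rewrite IE.
exact: (Ex_residual_le_cst (gaussX j) (meanX j) (covX j) t0 (loo_coercive j _)).
Qed.

(** The conditional mean of the quadratic form is the leave-one-out trace, which
    is within [sigma / t] of [tau]. *)
Let loo_dev j w : (\tr (Sigma *m invmx (loo j (Xc w))) - taub) ^+ 2 <=
  2 * (sg / t) ^+ 2 + 2 * (tau (Xc w) - taub) ^+ 2.
Proof.
have := tau_loo j (Xc w); rewrite ler_norml => /andP[h1 h2].
move: h1 h2; set x := tau _; set y := \tr _; set z := sg / t => h1 h2.
have h : 0 <= (z - (x - y)) * (z + (x - y)) by rewrite mulr_ge0//; lra.
have h' := sqr_ge0 ((x - taub) + (x - y)); nra.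
Qed.

Let C0 : 0 <= C.
Proof. by have := le_trans (ler0n R p) pC; rewrite pmulr_lge0. Qed.

Let Kvar : R := 3 / (2 * t ^+ 4) + (C + 3) / t ^+ 2 + 1 / t ^+ 3.

(** The bound for one vector with [l = sqrt n], integrated over the other vectors;
    [p <= C n] and the variance of [tau] make every term of order
    [sqrt n sigma^2]. *)
Let Ex_residual_var j :
  `|\int[P]_w residual j (Xc w)| <= s j * (lam * sg ^+ 2) * Kvar.
Proof.
have [I [iI -> IE]] := Ex_residual_fubini j.
pose K0 := s j * ((lam * (3 * sg ^+ 2 / t ^+ 4) +
  (2 * p%:R * sg ^+ 2 / t ^+ 2 + 2 * (sg / t) ^+ 2) / lam) / 2 + sg ^+ 2 / t ^+ 3).
have iK := integrableRZ (s j / lam) int_tau_dev.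
have i0 := integrableR_cst P K0.
apply: (@le_trans _ _ (\int[P]_w (K0 + s j / lam * (tau (Xc w) - taub) ^+ 2))).
  apply: normr_Ex_le => // [|w]; first exact: integrableRD.
  rewrite IE; apply: le_trans (Ex_residual_le_var (gaussX j) (meanX j) (covX j)
    t0 (loo_coercive j (Xc w)) sg0 Sle (s0 j) taub_ge0 v_le u_le lam0) _.
  have li : 0 <= s j * (lam^-1 / 2) by rewrite !mulr_ge0// ?invr_ge0 ltW.
  have := ler_wpM2l li (loo_dev j w); rewrite /K0.
  set y := (\tr _ - taub) ^+ 2; set x := (tau _ - taub) ^+ 2 => h.
  rewrite [leLHS](_ : _ = s j * ((lam * (3 * sg ^+ 2 / t ^+ 4) +
    2 * p%:R * sg ^+ 2 / t ^+ 2 / lam) / 2 + sg ^+ 2 / t ^+ 3) +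
    s j * (lam^-1 / 2) * y); last by ring.
  apply: le_trans (lerD (lexx _) h) _.
  rewrite le_eqVlt; apply/orP; left; apply/eqP; field.
  by rewrite !gt_eqF.
rewrite (ExD i0 iK) Ex_cst (ExZ _ int_tau_dev).
have sl : 0 <= s j / lam by rewrite divr_ge0// ltW.
apply: le_trans (lerD (lexx _) (ler_wpM2l sl variance_tau)) _.
have h1 : s j / lam * (p%:R * sg ^+ 2 / t ^+ 2) <=
    s j / lam * (C * n%:R * sg ^+ 2 / t ^+ 2).
  by rewrite ler_wpM2l// !ler_wpM2r ?invr_ge0 ?sqr_ge0.
have h2 : s j / lam * (1 * (sg / t) ^+ 2) <= s j / lam * (n%:R * (sg / t) ^+ 2).
  by rewrite ler_wpM2l// ler_wpM2r ?sqr_ge0.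
have h3 : s j * (1 * (sg ^+ 2 / t ^+ 3)) <= s j * (lam * (sg ^+ 2 / t ^+ 3)).
  by rewrite ler_wpM2l// ler_wpM2r// divr_ge0 ?sqr_ge0// exprn_ge0// ltW.
have -> : s j * (lam * sg ^+ 2) * Kvar = s j * (lam * (3 * sg ^+ 2 / t ^+ 4)) / 2 +
   s j / lam * (C * n%:R * sg ^+ 2 / t ^+ 2) + s j / lam * (n%:R * (sg / t) ^+ 2) +
   s j / lam * (2 * n%:R * sg ^+ 2 / t ^+ 2) + s j * (lam * (sg ^+ 2 / t ^+ 3)).
  by rewrite /Kvar -lam_sqr; field; rewrite !gt_eqF.
have -> : K0 = s j * (lam * (3 * sg ^+ 2 / t ^+ 4)) / 2 +
   s j / lam * (p%:R * sg ^+ 2 / t ^+ 2) + s j / lam * (1 * (sg / t) ^+ 2) +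
   s j * (1 * (sg ^+ 2 / t ^+ 3)).
  by rewrite /K0; field; rewrite !gt_eqF.
by move: h1 h2 h3; lra.
Qed.

Let measurable_quadQ : measurable_config (fun c => dotv v (Q c *m v)).
Proof.
apply: measurable_dotv; first exact: measurable_mx_cst.
by apply: measurable_mxM => //; exact: measurable_mx_cst.
Qed.

Let dotv_inv_le M : coercive t M -> `|dotv v (invmx M *m v)| <= 1 / t.
Proof.
move=> Mt; have := le_dotv v_le (enorm_inv_le t0 Mt v_le).
by rewrite (mul1r (1 / t)).
Qed.

Lemma integrable_quad_resolvent :
  integrableR P (fun w => dotv v (invmx (regularized (Xc w)) *m v)).
Proof.
apply: (@integrableR_bounded _ _ _ _ _ (1 / t)).
  exact: (measurable_config_comp measurable_quadQ mX).
by move=> w; apply: dotv_inv_le; exact: regularized_coercive.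
Qed.

Let mn j : R := Num.min sg (s j * (lam * sg ^+ 2)).

Let Kres : R := 3 / t ^+ 2 + Kvar.

Let resolvent_to_det :
  `|\int[P]_w dotv v (Q (Xc w) *m v) - dotv v u| <= Kres * \sum_j s j * mn j.
Proof.
have i1 := integrable_quad_resolvent.
rewrite -{1}(Ex_cst P (dotv v u)) -(ExB i1 (integrableR_cst P _)).
under eq_Ex do rewrite resolvent_expansion.
rewrite (Ex_sum _ (fun j => integrableRZ (s j) (int_residual j))).
apply: le_trans (ler_norm_sum _ _ _) _; rewrite mulr_sumr; apply: ler_sum => j _.
rewrite (ExZ _ (int_residual j)) normrM (ger0_norm (s0 j)) mulrCA ler_wpM2l//.
have t2 : 0 <= 3 / t ^+ 2 by rewrite divr_ge0// exprn_ge0// ltW.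
have tv : 0 <= Kvar.
  by rewrite !addr_ge0// divr_ge0 ?mulr_ge0 ?exprn_ge0 ?addr_ge0// ltW.
have sl : 0 <= s j * (lam * sg ^+ 2) by rewrite !mulr_ge0 ?sqr_ge0// ltW.
have Kres0 : 0 <= Kres by exact: addr_ge0.
rewrite /mn minr_pMr// le_min; apply/andP; split.
  by apply: le_trans (Ex_residual_cst j) _; rewrite mulrAC ler_wpM2r// lerDl.
apply: le_trans (Ex_residual_var j) _.
by rewrite mulrC ler_wpM2r// lerDr.
Qed.

Definition gamma_of (x : R) : R := \sum_j s j / (1 + s j * x).

Let gam w := gamma_of (tau (Xc w)).

Let gam0 w : 0 <= gam w.
Proof.
by apply: sumr_ge0 => j _; rewrite mulr_ge0// invr_ge0 addr_ge0// mulr_ge0.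
Qed.

Let measurable_tauX : measurable_fun setT (fun w => tau (Xc w)).
Proof. exact: (measurable_config_comp measurable_tau mX). Qed.

Let measurable_gam : measurable_fun setT gam.
Proof.
apply: measurable_sum => j; apply: measurable_funM; first exact: measurable_cst.
apply: measurable_funV_pos => [|w]; last by rewrite ltr_pwDl// mulr_ge0.
apply: measurable_funD; first exact: measurable_cst.
by apply: measurable_funM; first exact: measurable_cst.
Qed.

Let quadG w := dotv v (invmx (gam w *: Sigma + A) *m v).

Lemma integrable_quad_gamma : integrableR P
  (fun w => dotv v (invmx (gamma_of (\tr (Sigma *m invmx (regularized (Xc w))))
    *: Sigma + A) *m v)).
Proof.
apply: (@integrableR_bounded _ _ _ _ _ (1 / t)); last first.
  by move=> w; apply: dotv_inv_le; exact: gbS_coercive (gam0 w).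
apply: measurable_dotv; first exact: measurable_mx_cst.
apply: measurable_mxM; last exact: measurable_mx_cst.
apply: measurable_invmx => [|w]; last first.
  exact: (coercive_unit t0 (gbS_coercive (gam0 w))).
apply: measurable_mxD; last exact: measurable_mx_cst.
by apply: measurable_mxZ => //; exact: measurable_mx_cst.
Qed.

Let quadG_dist w : `|quadG w - dotv v u| <= sg / t / t * `|gb - gam w|.
Proof.
have GU := coercive_unit t0 (gbS_coercive gb0).
have HU := coercive_unit t0 (gbS_coercive (gam0 w)).
set H := invmx (gam w *: Sigma + A).
have uE : (gb *: Sigma + A) *m u = v by rewrite mulmxA mulmxV// mul1mx.
have -> : quadG w - dotv v u = (gb - gam w) * dotv v (H *m (Sigma *m u)).
  have -> : dotv v u = dotv v (H *m ((gam w *: Sigma + A) *m u)).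
    by rewrite (mulmxA H) mulVmx// mul1mx.
  rewrite /quadG -/H -dotvBr -mulmxBr -{2}uE -mulmxBl opprD addrACA subrr addr0.
  by rewrite -scalerBl -scalemxAl -scalemxAr dotvZr.
rewrite normrM mulrC ler_wpM2r//.
have Su : euclidean_norm (Sigma *m u) <= sg / t.
  by apply: le_trans (Sle u) _; rewrite ler_wpM2l// -[t^-1]mul1r.
have := le_dotv v_le (enorm_inv_le t0 (gbS_coercive (gam0 w)) Su).
by rewrite mul1r.
Qed.

Let dev w := tau (Xc w) - taub.

Let gamma_dist w :
  `|gb - gam w| <= \sum_j s j * Num.min 1 (s j * `|dev w|).
Proof.
rewrite /gb /gam /gamma_of -sumrB.
apply: le_trans (ler_norm_sum _ _ _) _; apply: ler_sum => j _.
rewrite -mulrBr normrM (ger0_norm (s0 j)) ler_wpM2l//.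
by have := inv1D_dist (s0 j) taub_ge0 (tau_ge0 (Xc w)); rewrite [`|taub - _|]distrC.
Qed.

Let gamma_term j w := sg * Num.min 1 (s j * `|dev w|).

Let gamma_term_ge0 j w : 0 <= gamma_term j w.
Proof. by rewrite mulr_ge0// le_min ler01 mulr_ge0. Qed.

Let gamma_term_le1 j w : gamma_term j w <= sg.
Proof. by rewrite ler_piMr// ge_min lexx. Qed.

Let measurable_dev : measurable_fun setT dev.
Proof. by apply: measurable_funB => //; exact: measurable_cst. Qed.

Let int_gamma_term j : integrableR P (gamma_term j).
Proof.
apply: (@integrableR_bounded _ _ _ _ _ sg); last first.
  by move=> w; rewrite ger0_norm.
apply: measurable_funM; first exact: measurable_cst.
apply: measurable_minr; first exact: measurable_cst.
apply: measurable_funM; first exact: measurable_cst.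
exact: (measurableT_comp (@normr_measurable R setT)).
Qed.

(** The second bound uses
    [sigma |x| <= (sqrt n sigma^2 + x^2 / sqrt n) / 2] with [x] the deviation of
    [tau], whose second moment is of order [n sigma^2]. *)
Let Ex_gamma_term j :
  \int[P]_w gamma_term j w <= (1 + 1 / t ^+ 2) * mn j.
Proof.
have t2 : 0 <= 1 / t ^+ 2 by rewrite divr_ge0// exprn_ge0// ltW.
rewrite /mn minr_pMr ?addr_ge0// le_min; apply/andP; split.
  apply: (@le_trans _ _ sg); last by rewrite -[leLHS]mul1r ler_wpM2r// lerDl.
  by rewrite -[leRHS](Ex_cst P sg); apply: le_Ex => //; exact: integrableR_cst.
pose c := s j / (2 * lam); have c0 : 0 <= c by rewrite divr_ge0// mulr_ge0// ltW.
have ic := integrableR_cst P (s j * (lam * sg ^+ 2) / 2).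
have id := integrableRZ c int_tau_dev.
apply: (@le_trans _ _ (\int[P]_w (s j * (lam * sg ^+ 2) / 2 + c * dev w ^+ 2))).
  apply: le_Ex => // [|w]; first exact: integrableRD.
  apply: (@le_trans _ _ (s j * (sg * `|dev w|))).
    by rewrite /gamma_term mulrCA ler_wpM2l// ge_min lexx orbT.
  rewrite -(real_normK (num_real (dev w))).
  move: `|dev w| => x.
  have h : 0 <= c * (lam * sg - x) ^+ 2 by rewrite mulr_ge0 ?sqr_ge0.
  rewrite -subr_ge0; apply: le_trans h _.
  by rewrite le_eqVlt; apply/orP; left; apply/eqP; rewrite /c; field; rewrite gt_eqF.
rewrite (ExD ic id) Ex_cst (ExZ _ int_tau_dev).
apply: le_trans (lerD (lexx _) (ler_wpM2l c0 variance_tau)) _.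
have -> : c * (2 * n%:R * sg ^+ 2 / t ^+ 2) = 1 / t ^+ 2 * (s j * (lam * sg ^+ 2)).
  by rewrite /c -lam_sqr; field; rewrite !gt_eqF.
have : 0 <= s j * (lam * sg ^+ 2) by rewrite !mulr_ge0 ?sqr_ge0// ltW.
lra.
Qed.

Let Kgam : R := t^-1 ^+ 2 * (1 + 1 / t ^+ 2).

Let gamma_to_det :
  `|\int[P]_w quadG w - dotv v u| <= Kgam * \sum_j s j * mn j.
Proof.
have i1 : integrableR P quadG := integrable_quad_gamma.
have i0 := integrableR_cst P (dotv v u).
rewrite -{1}(Ex_cst P (dotv v u)) -(ExB i1 i0).
have ij j := integrableRZ (t^-1 ^+ 2 * s j) (int_gamma_term j).
have iS := integrableR_sum (index_enum 'I_n) ij.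
apply: le_trans (normr_Ex_le (integrableRB i1 i0) iS _) _ => [w|].
  apply: le_trans (quadG_dist w) _.
  apply: le_trans (ler_wpM2l _ (gamma_dist w)) _; first by rewrite !mulr_ge0.
  rewrite mulr_sumr le_eqVlt; apply/orP; left; apply/eqP.
  by apply: eq_bigr => j _; rewrite /gamma_term expr2; ring.
rewrite (Ex_sum _ ij) mulr_sumr; apply: ler_sum => j _.
rewrite (ExZ _ (int_gamma_term j)).
have -> : Kgam * (s j * mn j) = t^-1 ^+ 2 * s j * ((1 + 1 / t ^+ 2) * mn j).
  by rewrite /Kgam; ring.
by rewrite ler_wpM2l// mulr_ge0// exprn_ge0.
Qed.

Lemma resolvent_deterministic_equivalent :
  `|\int[P]_w dotv v (invmx (regularized (Xc w)) *m v) -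
    \int[P]_w dotv v (invmx (gamma_of
      (\tr (Sigma *m invmx (regularized (Xc w)))) *: Sigma + A) *m v)| <=
  (3 / t ^+ 2 + (3 / (2 * t ^+ 4) + (C + 3) / t ^+ 2 + 1 / t ^+ 3) +
     t^-1 ^+ 2 * (1 + 1 / t ^+ 2)) *
  \sum_j s j * Num.min sg (s j * (Num.sqrt n%:R * sg ^+ 2)).
Proof.
rewrite mulrDl; apply: le_trans (lerD resolvent_to_det gamma_to_det).
apply: le_trans (ler_distD (dotv v u) _ _) _.
by rewrite lerD2l distrC.
Qed.

End fixed_sample_size.

(** * Passage to the limit *)

Theorem proposition3p1 (R : realType) (p : nat -> nat)
  (d : nat -> measure_display) (T : forall n : nat, measurableType (d n))
  (P : forall n : nat, probability (T n) R)
  (X : forall n : nat, 'I_n -> {RV (P n) >-> (p n).-tuple R})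
  (Sigma A : forall n : nat, 'M[R]_(p n))
  (r : forall n : nat, 'I_n -> R)
  (v : forall n : nat, 'cV[R]_(p n))
  (t : R)
  (indepX : forall n : nat, (0 < n)%N -> mutually_independent (X n))
  (gaussX : forall (n : nat) (j : 'I_n), gaussian_vector (X n j))
  (meanX : forall (n : nat) (j : 'I_n), centered (X n j))
  (covX : forall (n : nat) (j : 'I_n), has_covariance (X n j) (Sigma n))
  (r_gt0 : forall (n : nat) (j : 'I_n), 0 < r n j)
  (t_gt0 : 0 < t)
  (A_ge : forall n : nat, (0 < n)%N -> loewner_le t%:M (A n))
  (v_unit : forall n : nat, (0 < n)%N -> euclidean_norm (v n) = 1)
  (pn_bounded : exists C : R,
     forall n : nat, (0 < n)%N -> (p n)%:R / n%:R <= C)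
  (sum_bigO : (fun n : nat =>
       \sum_(j < n) r n j ^+ 2 / n%:R * operator_norm (Sigma n))
     =O_\oo (fun=> 1 : R))
  (sum_littleo : (fun n : nat =>
       \sum_(j < n)
          Num.min (r n j ^+ 2 / n%:R)
                  (r n j ^+ 4 / (n%:R `^ (3 / 2)) * operator_norm (Sigma n))
          * operator_norm (Sigma n))
     =o_\oo (fun=> 1 : R)) :
  (fun n : nat =>
     'E_(P n)[fun w => quad_form (invmx (weighted_cov (r n) (X n) w + A n)%R) (v n)]
     - 'E_(P n)[fun w =>
          quad_form (invmx (gamma (r n) (X n) (Sigma n) (A n) w *: Sigma n + A n)%R)
                    (v n)])%E
    @ \oo --> 0%E.

Proof.
pose s n (j : 'I_n) : R := r n j ^+ 2 / n%:R.
pose sg n := operator_norm (Sigma n).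
have [C hC] := pn_bounded.
have covE n w : weighted_cov (r n) (X n) w + A n =
    regularized (A n) (s n) (fun i => X n i w).
  rewrite /weighted_cov /regularized scaler_sumr; congr (_ + _).
  by apply: eq_bigr => j _; rewrite scalerA mulrC.
have gammaE n w : gamma (r n) (X n) (Sigma n) (A n) w = gamma_of (s n)
    (\tr (Sigma n *m invmx (regularized (A n) (s n) (fun i => X n i w)))).
  rewrite /gamma /gamma_of mulr_sumr; apply: eq_bigr => j _.
  by rewrite covE /s mulrA (mulrC (n%:R^-1)).
pose a n := \int[P n]_w dotv (v n)
  (invmx (regularized (A n) (s n) (fun i => X n i w)) *m v n).
pose b n := \int[P n]_w dotv (v n) (invmx (gamma_of (s n)
  (\tr (Sigma n *m invmx (regularized (A n) (s n) (fun i => X n i w))))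
    *: Sigma n + A n) *m v n).
pose K := 3 / t ^+ 2 + (3 / (2 * t ^+ 4) + (C + 3) / t ^+ 2 + 1 / t ^+ 3) +
     t^-1 ^+ 2 * (1 + 1 / t ^+ 2).
have s_ge0 n j : 0 <= s n j by rewrite divr_ge0 ?sqr_ge0.
have estimate n : (0 < n)%N -> `|a n - b n| <= K *
    \sum_(j < n) Num.min (r n j ^+ 2 / n%:R)
      (r n j ^+ 4 / (n%:R `^ (3 / 2)) * operator_norm (Sigma n))
      * operator_norm (Sigma n).
  move=> n0.
  have pC : (p n)%:R <= C * n%:R by rewrite -ler_pdivrMr ?ltr0n// hC.
  apply: le_trans (resolvent_deterministic_equivalent n0 (indepX n n0) (gaussX n)
    (meanX n) (covX n) (s_ge0 n) t_gt0 (loewner_ge_coercive (A_ge n n0))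
    (v_unit n n0) (operator_norm_ge0 _) (enorm_mulmx (Sigma n)) pC) _.
  rewrite -/K le_eqVlt; apply/orP; left; apply/eqP; congr (K * _).
  apply: eq_bigr => j _; rewrite -/(sg n).
  have sg0 : 0 <= sg n by exact: operator_norm_ge0.
  rewrite minr_pMr// minr_pMl//; congr Num.min.
  have n0R : 0 < n%:R :> R by rewrite ltr0n.
  have -> : n%:R `^ (3 / 2) = n%:R * Num.sqrt n%:R :> R.
    rewrite (_ : 3 / 2 = 1 + 2^-1 :> R); last by field.
    rewrite powRD; first by rewrite powRr1 ?powR12_sqrt ?ltW.
    by rewrite gt_eqF ?implybT.
  have sq : Num.sqrt n%:R ^+ 2 = n%:R :> R by rewrite sqr_sqrtr ?ltW.
  have sq0 : 0 < Num.sqrt n%:R :> R by rewrite sqrtr_gt0.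
  rewrite /s; move: sq sq0; move: (Num.sqrt n%:R) => q sq q0.
  by rewrite -sq; field; rewrite gt_eqF.
have EE n : (0 < n)%N ->
    ('E_(P n)[fun w => quad_form (invmx (weighted_cov (r n) (X n) w + A n)%R) (v n)]
     - 'E_(P n)[fun w =>
          quad_form (invmx (gamma (r n) (X n) (Sigma n) (A n) w *: Sigma n + A n)%R)
                    (v n)])%E = (a n - b n)%:E.
  move=> n0; have At := loewner_ge_coercive (A_ge n n0).
  rewrite unlock EFinB; congr (_ - _)%E.
    rewrite -(integral_EFin_Ex (integrable_quad_resolvent (X n) (s_ge0 n) t_gt0 At
      (v_unit n n0))).
    by apply: eq_integral => w _; rewrite quad_formE covE.
  rewrite -(integral_EFin_Ex (integrable_quad_gamma n0 (gaussX n) (meanX n)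
    (covX n) (s_ge0 n) t_gt0 At (v_unit n n0))).
  by apply: eq_integral => w _; rewrite quad_formE gammaE.
have small := eqolim0 sum_littleo.
have ab0 : (a n - b n) @[n --> \oo] --> (0 : R).
  apply/norm_cvg0P.
  have := cvgM (cvg_cst K) small; rewrite mulr0 => Ksmall.
  apply: (squeeze_cvgr _ (cvg_cst 0) (Ksmall _ _)).
  near=> n; rewrite normr_ge0 /=; apply: estimate.
  by near: n; exists 1%N.
apply: (@cvg_trans _ ((fun n => (a n - b n)%:E) @ \oo)).
  by apply: near_eq_cvg; near=> n; rewrite EE//; near: n; exists 1%N.
by apply: cvg_EFin; [exact: nearW|exact: ab0].
Unshelve. all: by end_near. Qed.
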